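(* Let $F$ be a finitely generated free group of rank at least two. The image of the homomorphism $d^F : \mathrm{Comm}(F) \to \mathbb{Z}^{(\mathcal{FS})}$ is \[ d^F(\mathrm{Comm}(F)) = \Bigl\{ (x_S)_{S\in\mathcal{FS}} \in \mathbb{Z}^{(\mathcal{FS})} \; : \; \prod_{S\in\mathcal{FS}} |S|^{x_S} = 1 \Bigr\}. \] In particular it is a free abelian group of infinite rank.
   Context: A virtual isomorphism of a group $\Gamma$ is an isomorphism $\varphi: A \to B$ between finite index subgroups $A,B$ of $\Gamma$. Two virtual isomorphisms are equivalent if they agree on a common finite index subgroup of their domains; $[\varphi]$ denotes the equivalence class. The composition of $\varphi: A\to B$ followed by $\psi: C \to D$ is the isomorphism $\varphi^{-1}(B\cap C) \to \psi(B\cap C)$, $x \mapsto \psi(\varphi(x))$. Equivalence classes form a group under composition, the abstract commensurator $\mathrm{Comm}(\Gamma)$. A virtual isomorphism $\varphi : A\to B$ is $\Gamma$-subnormal if both $A$ and $B$ are subnormal in $\Gamma$; every element of $\mathrm{Comm}(\Gamma)$ has a $\Gamma$-subnormal representative. $\mathcal{FS}$ is the collection of isomorphism classes of finite simple groups (including cyclic groups of prime order). $\mathbb{Z}^{(\mathcal{FS})}$ is the free abelian group with basis $\mathcal{FS}$ (finitely supported functions $\mathcal{FS}\to\mathbb{Z}$), and $\delta_S$ is the Dirac function at $S$. If $A$ is a finite index subnormal subgroup of $\Gamma$, a composition series going from $A$ to $\Gamma$ is a finite series $(A_\ell,\dots,A_0)$ with $A_\ell = A$, $A_0=\Gamma$,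 each $A_{i+1}$ normal in $A_i$ and $A_i/A_{i+1}$ finite simple. For $S \in \mathcal{FS}$, $n_S^\Gamma(A)$ is the number of indices $i$ with $A_i/A_{i+1} \simeq S$ (independent of the series). The map $d^\Gamma : \mathrm{Comm}(\Gamma)\to \mathbb{Z}^{(\mathcal{FS})}$ is the (well-defined) group homomorphism $d^\Gamma(c) = \sum_{S} (n_S^\Gamma(B)-n_S^\Gamma(A))\delta_S$, where $\varphi : A\to B$ is any $\Gamma$-subnormal representative of $c$. *)

(* Defs.v *)
From HB Require Import structures.
From mathcomp Require Import all_boot all_order all_algebra all_fingroup.
From mathcomp Require Import all_solvable finmap all_classical.
From mathcomp.multinomials Require Import monalg.

Set Implicit Arguments.
Unset Strict Implicit.
Unset Printing Implicit Defensive.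

Import GRing.Theory.
Local Open Scope quotient_scope.
Local Open Scope classical_set_scope.
Local Open Scope group_scope.

(* A group may be infinite: it is a [groupType], and its subgroups are        *)
(* handled as [set G] satisfying [subgroup].                                  *)

Section Subgroups.
Context {G : groupType}.
Implicit Types (A B C N : set G) (x y : G).

Definition subgroup A : Prop := A 1 /\ forall x y, A x -> A y -> A (x * y^-1).

Definition left_coset x N : set G := [set x * y | y in N].

Definition left_cosets A N : set (set G) := [set left_coset x N | x in A].

Definition finite_index A : Prop := finite_set (left_cosets setT A).

Definition normal_subgroup N A : Prop :=
  [/\ subgroup N, subgroup A, N `<=` A & forall x y, A x -> N y -> N (y ^ x)].

(* The quotient A / N is the set of cosets of N in A, with the group law      *)
(* (xN)(yN) = (xy)N; this says that it is isomorphic to the finite group K.   *)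
Definition quotient_iso A N (gT : finGroupType) (K : {group gT}) : Prop :=
  exists h : set G -> gT,
    set_bij (left_cosets A N) [set` K] h /\
    forall x y, A x -> A y ->
      h (left_coset (x * y) N) = h (left_coset x N) * h (left_coset y N).

Definition subnormal_subgroup A : Prop :=
  exists (l : nat) (s : nat -> set G),
    [/\ s 0 = setT, s l = A &
        forall i, (i < l)%N -> normal_subgroup (s i.+1) (s i)].

End Subgroups.

(* Universal property, among groups, of the family e in F. *)
Definition free_basis (F : groupType) (I : Type) (e : I -> F) : Prop :=
  forall (H : groupType) (f : I -> H),
    exists! g : F -> H, {morph g : x y / x * y} /\ forall i, g (e i) = f i.

(* By Cayley's theorem every finite group is isomorphic to a subgroup of some *)
(* 'S_n, so that FS, obtained by identifying the isomorphic ones among the    *)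
(* simple subgroups of the 'S_n, is the set of isomorphism classes of finite  *)
(* simple groups; see [FS_surj] and [FS_inj].                                 *)

Definition simple_perm_group : Type :=
  {G : {n : nat & {group 'S_n}} | simple (tagged G)}.

HB.instance Definition _ := Choice.on simple_perm_group.

Definition isog_rel (G H : simple_perm_group) : bool :=
  isog (tagged (val G)) (tagged (val H)).

Fact isog_rel_equiv : equiv_class_of isog_rel.
Proof.
split; first by move=> G; apply: isog_refl.
  by move=> G H; rewrite /isog_rel isog_sym.
by move=> G H K; apply: isog_trans.
Qed.

Canonical isog_rel_equivRel := EquivRelPack isog_rel_equiv.

Definition FS : Type := {eq_quot isog_rel}.
HB.instance Definition _ := Choice.on FS.
HB.instance Definition _ := EqQuotient.on FS.

Definition FSgroup (S : FS) : {group 'S_(tag (val (generic_quotient.repr S)))} :=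
  tagged (val (generic_quotient.repr S)).

Definition FSorder (S : FS) : nat := #|FSgroup S|.

Section Cayley.
Variables (gT : finGroupType) (G : {group gT}).

Let mulr_ord (x : gT) (i : 'I_#|gT|) : 'I_#|gT| :=
  enum_rank (enum_val i * x).

Let mulr_ord_inj x : injective (mulr_ord x).
Proof. by move=> i j /enum_rank_inj /mulIg /enum_val_inj. Qed.

Let cayley (x : gT) : 'S_#|gT| := perm (@mulr_ord_inj x).

Let cayleyM : {in G &, {morph cayley : x y / x * y}}.
Proof.
move=> x y _ _; apply/permP => i.
by rewrite permM !permE /mulr_ord enum_rankK mulgA.
Qed.

Lemma isog_perm_group : exists H : {group 'S_#|gT|}, G \isog H.
Proof.
pose f := Morphism cayleyM; exists (f @* G)%G.
apply/isogP; exists f => //; apply/injmP => x y _ _.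
move=> /permP/(_ (enum_rank 1)); rewrite !permE /mulr_ord.
by move=> /enum_rank_inj; rewrite enum_rankK !mul1g.
Qed.

End Cayley.

Lemma FS_simple S : simple (FSgroup S).
Proof. exact: (valP (generic_quotient.repr S)). Qed.

Lemma FS_surj (gT : finGroupType) (G : {group gT}) :
  simple G -> exists S : FS, G \isog FSgroup S.
Proof.
move=> sG; have [H isoGH] := isog_perm_group G.
have sH : simple H by rewrite -(isog_simple isoGH).
pose K : simple_perm_group := exist _ (existT _ #|gT| H) sH.
exists (\pi_FS K); apply: (isog_trans isoGH).
have /eqmodP : K = generic_quotient.repr (\pi_FS K) %[mod FS] by rewrite reprK.
by [].
Qed.

Lemma FS_inj (S T : FS) : FSgroup S \isog FSgroup T -> S = T.
Proof. by move=> isoST; rewrite -[S]reprK -[T]reprK; apply/eqmodP. Qed.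

Section VirtualIsomorphism.
Variable G : groupType.

(* The values of [vi_fun] outside [vi_dom] are irrelevant. *)
Record virtual_iso := VirtualIso {
  vi_dom : set G;
  vi_cod : set G;
  vi_fun : G -> G;
  vi_dom_subgroup : subgroup vi_dom;
  vi_cod_subgroup : subgroup vi_cod;
  vi_dom_finite_index : finite_index vi_dom;
  vi_cod_finite_index : finite_index vi_cod;
  vi_bij : set_bij vi_dom vi_cod vi_fun;
  vi_morph : forall x y, vi_dom x -> vi_dom y ->
    vi_fun (x * y) = vi_fun x * vi_fun y }.

HB.instance Definition _ := gen_eqMixin virtual_iso.
HB.instance Definition _ := gen_choiceMixin virtual_iso.

Definition vi_equiv (f g : virtual_iso) : Prop :=
  exists C : set G,
    [/\ subgroup C, finite_index C, C `<=` vi_dom f, C `<=` vi_dom g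
      & forall x, C x -> vi_fun f x = vi_fun g x].

Definition vi_subnormal (f : virtual_iso) : Prop :=
  subnormal_subgroup (vi_dom f) /\ subnormal_subgroup (vi_cod f).

End VirtualIsomorphism.

Section SubgroupTheory.
Context {G : groupType}.
Implicit Types (A B C : set G) (x y : G).

Lemma subgroupV A x : subgroup A -> A x -> A x^-1.
Proof. by case=> A1 AD Ax; rewrite -[x^-1]mul1g; apply: AD. Qed.

Lemma subgroupM A x y : subgroup A -> A x -> A y -> A (x * y).
Proof.
by move=> sA Ax Ay; rewrite -[y]invgK; apply: sA.2 => //; apply: subgroupV.
Qed.

Lemma subgroupT : subgroup [set: G]. Proof. by []. Qed.

Lemma subgroupI A B : subgroup A -> subgroup B -> subgroup (A `&` B).
Proof.
by move=> sA sB; split=> [|x y [Ax Bx] [Ay By]]; split;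
  [apply: sA.1|apply: sB.1|apply: sA.2|apply: sB.2].
Qed.

Lemma left_coset_id A x y : subgroup A -> A (x^-1 * y) ->
  left_coset x A = left_coset y A.
Proof.
move=> sA Axy; apply/seteqP; split=> _ [a Aa <-].
- exists ((x^-1 * y)^-1 * a).
    by apply: subgroupM => //; apply: subgroupV.
  by rewrite invgM invgK !mulgA mulgV mul1g.
- exists (x^-1 * y * a); first exact: subgroupM.
  by rewrite !mulgA mulgV mul1g.
Qed.

Lemma finite_indexT : finite_index [set: G].
Proof.
apply: (@sub_finite_set _ _ [set [set: G]]); last exact: finite_set1.
move=> _ [x _ <-]; apply/seteqP; split=> // y _.
by exists (x^-1 * y) => //; rewrite mulgA mulgV mul1g.
Qed.

Lemma finite_indexI A B : finite_index A -> finite_index B ->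
  finite_index (A `&` B).
Proof.
move=> fA fB; have fAB := finite_setX fA fB.
apply: sub_finite_set (finite_image (fun P : set G * set G => P.1 `&` P.2) fAB).
move=> _ [x _ <-]; exists (left_coset x A, left_coset x B).
  by split; exists x.
apply/seteqP; split=> [y /= [[a Aa <-] [b Bb /mulgI eba]]|_ [y [Ay By] <-]].
  by exists a => //; split=> //; rewrite -eba.
by split; exists y.
Qed.

End SubgroupTheory.

Section Transport.
Context {G : groupType} {A B : set G} {f : G -> G}.
Hypotheses (sA : subgroup A) (sB : subgroup B) (fB : finite_index B).
Hypotheses (bij_f : set_bij A B f).
Hypotheses (fM : forall x y, A x -> A y -> f (x * y) = f x * f y).

Lemma vi_fun1 : f 1 = 1.
Proof. by apply: (mulgI (f 1)); rewrite -fM ?mulg1 //; apply: sA.1. Qed.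

Lemma vi_funV x : A x -> f x^-1 = (f x)^-1.
Proof.
move=> Ax; apply: (mulgI (f x)).
by rewrite -fM ?mulgV ?vi_fun1 //; apply: subgroupV.
Qed.

Lemma subgroup_image C : subgroup C -> C `<=` A -> subgroup (f @` C).
Proof.
move=> sC sCA; split; first by exists 1; [apply: sC.1|apply: vi_fun1].
move=> _ _ [x Cx <-] [y Cy <-]; exists (x * y^-1); first exact: sC.2.
by rewrite fM ?vi_funV //; [apply: sCA..|apply: subgroupV => //; apply: sCA].
Qed.

Lemma subgroup_preimage D : subgroup D -> subgroup (A `&` f @^-1` D).
Proof.
move=> sD; split=> [|x y [Ax Dx] [Ay Dy]].
  by split; [apply: sA.1|rewrite /= vi_fun1; apply: sD.1].
have AVy := subgroupV sA Ay.
by split; [exact: subgroupM|rewrite /= fM // vi_funV //; apply: sD.2].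
Qed.

Lemma finite_index_image C : C `<=` A -> finite_index C ->
  finite_index (f @` C).
Proof.
move=> sCA fC; have fBC := finite_setX fB fC.
pose h (P : set G * set G) := [set xget 1 P.1 * f q | q in P.2].
apply: sub_finite_set (finite_image h fBC) => _ [x _ <-].
set P := left_coset x B.
have /xgetPex : exists y, P y by exists (x * 1); exists 1 => //; apply: sB.1.
move=> /(_ 1) [b Bb def_r]; have [_ _ surj_f] := bij_f.
have [a Aa fa] := surj_f _ (subgroupV sB Bb).
exists (P, left_coset a C); first by split; [exists x|exists a].
rewrite /h /= -def_r; apply/seteqP; split.
- move=> _ [_ [c Cc <-] <-]; exists (f c); first by exists c.
  by rewrite fM ?fa ?mulgA ?mulgK //; exact: sCA.
- move=> _ [_ [c Cc <-] <-]; exists (a * c); first by exists c.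
  by rewrite fM ?fa ?mulgA ?mulgK //; exact: sCA.
Qed.

End Transport.

Section CommensuratorOperations.
Variable G : groupType.
Implicit Types f g h : virtual_iso G.

Definition vi_id : virtual_iso G.
Proof.
exists setT setT id => //; do ?[exact: subgroupT|exact: finite_indexT].
by split=> // x _; exists x.
Defined.

Let inv_fun f := 'pinv_(fun=> 1) (vi_dom f) (vi_fun f).

Lemma vi_funK f x : vi_dom f x -> inv_fun f (vi_fun f x) = x.
Proof.
move=> fx; have [_ inj_f _] := vi_bij f.
by apply: pinvKV; rewrite ?inE.
Qed.

Lemma vi_inv_funK f x : vi_cod f x -> vi_fun f (inv_fun f x) = x.
Proof.
have [_ _ surj_f] := vi_bij f.
by move=> /surj_f fx; apply: pinvK; rewrite inE.
Qed.

Fact vi_inv_bij f : set_bij (vi_cod f) (vi_dom f) (inv_fun f).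
Proof. exact: bijpinv_bij (vi_bij f). Qed.

Fact vi_inv_morph f x y : vi_cod f x -> vi_cod f y ->
  inv_fun f (x * y) = inv_fun f x * inv_fun f y.
Proof.
have [fun_f _ surj_f] := vi_bij f => /surj_f[a fa <-] /surj_f[b fb <-].
rewrite -vi_morph // !vi_funK //.
by apply: subgroupM => //; apply: vi_dom_subgroup.
Qed.

Definition vi_inv f : virtual_iso G :=
  VirtualIso (vi_cod_subgroup f) (vi_dom_subgroup f)
    (vi_cod_finite_index f) (vi_dom_finite_index f)
    (vi_inv_bij f) (@vi_inv_morph f).

Lemma finite_index_preimage f (D : set G) : subgroup D -> finite_index D ->
  finite_index (vi_dom f `&` vi_fun f @^-1` D).
Proof.
move=> sD fD; have [fun_f _ surj_f] := vi_bij f.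
suff -> : vi_dom f `&` vi_fun f @^-1` D = inv_fun f @` (vi_cod f `&` D).
  apply: (finite_index_image (vi_dom_subgroup f) (vi_dom_finite_index f)
            (vi_inv_bij f) (@vi_inv_morph f)); first by move=> x [].
  by apply: finite_indexI => //; apply: vi_cod_finite_index.
apply/seteqP; split=> [x [fx Dx]|_ [y [/surj_f[x fx <-] Dy] <-]].
  by exists (vi_fun f x); [split=> //; exact: fun_f|exact: vi_funK].
by rewrite vi_funK.
Qed.

Section Composition.
Variables g f : virtual_iso G.

(* f followed by g *)
Let dom := vi_dom f `&` vi_fun f @^-1` (vi_cod f `&` vi_dom g).
Let cod := vi_fun g @` (vi_cod f `&` vi_dom g).

Let sI : subgroup (vi_cod f `&` vi_dom g).
Proof.
by apply: subgroupI; [apply: vi_cod_subgroup|apply: vi_dom_subgroup].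
Qed.

Let fI : finite_index (vi_cod f `&` vi_dom g).
Proof.
by apply: finite_indexI; [apply: vi_cod_finite_index|apply: vi_dom_finite_index].
Qed.

Fact vi_comp_dom_subgroup : subgroup dom.
Proof. exact: subgroup_preimage (vi_dom_subgroup f) (@vi_morph _ f) _ sI. Qed.

Fact vi_comp_cod_subgroup : subgroup cod.
Proof.
apply: subgroup_image (vi_dom_subgroup g) (@vi_morph _ g) _ sI _.
exact: subIsetr.
Qed.

Fact vi_comp_dom_finite_index : finite_index dom.
Proof. exact: finite_index_preimage. Qed.

Fact vi_comp_cod_finite_index : finite_index cod.
Proof.
apply: (finite_index_image (vi_cod_subgroup g) (vi_cod_finite_index g)
          (vi_bij g) (@vi_morph _ g)) => //.
Qed.

Fact vi_comp_bij : set_bij dom cod (vi_fun g \o vi_fun f).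
Proof.
have [fun_f inj_f surj_f] := vi_bij f; have [fun_g inj_g surj_g] := vi_bij g.
split.
- by move=> x [fx Ix]; exists (vi_fun f x).
- move=> x y /set_mem[fx [_ gx]] /set_mem[fy [_ gy]] /= eq_xy.
  by apply: inj_f; rewrite ?inE //; apply: inj_g; rewrite ?inE.
- move=> _ [_ [/surj_f[x fx <-] gx] <-]; exists x => //.
  by split=> //; split=> //; exact: fun_f.
Qed.

Fact vi_comp_morph x y : dom x -> dom y ->
  (vi_fun g \o vi_fun f) (x * y) =
    (vi_fun g \o vi_fun f) x * (vi_fun g \o vi_fun f) y.
Proof. by move=> [fx [_ gx]] [fy [_ gy]] /=; rewrite !vi_morph. Qed.

Definition vi_comp : virtual_iso G :=
  VirtualIso vi_comp_dom_subgroup vi_comp_cod_subgroup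
    vi_comp_dom_finite_index vi_comp_cod_finite_index
    vi_comp_bij vi_comp_morph.

End Composition.

Lemma vi_equiv_refl f : vi_equiv f f.
Proof.
by exists (vi_dom f); split=> //;
  [apply: vi_dom_subgroup|apply: vi_dom_finite_index].
Qed.

Lemma vi_equiv_sym f g : vi_equiv f g -> vi_equiv g f.
Proof. by case=> C [sC fC Cf Cg eqC]; exists C; split=> // x /eqC. Qed.

Lemma vi_equiv_trans g f h : vi_equiv f g -> vi_equiv g h -> vi_equiv f h.
Proof.
move=> [C [sC fC Cf Cg eqC]] [D [sD fD Dg Dh eqD]].
exists (C `&` D); split; first exact: subgroupI.
- exact: finite_indexI.
- by move=> x [/Cf].
- by move=> x [_ /Dh].
- by move=> x [Cx Dx]; rewrite eqC ?eqD.
Qed.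

Lemma vi_equiv_comp g g' f f' : vi_equiv g g' -> vi_equiv f f' ->
  vi_equiv (vi_comp g f) (vi_comp g' f').
Proof.
move=> [D [sD fD Dg Dg' eqD]] [C [sC fC Cf Cf' eqC]].
have [fun_f _ _] := vi_bij f; have [fun_f' _ _] := vi_bij f'.
exists (C `&` (vi_dom f `&` vi_fun f @^-1` D)); split.
- apply: subgroupI => //.
  exact: subgroup_preimage (vi_dom_subgroup f) (@vi_morph _ f) _ sD.
- by apply: finite_indexI => //; apply: finite_index_preimage.
- by move=> x [Cx [fx Dx]]; split=> //; split; [exact: fun_f|exact: Dg].
- move=> x [Cx [fx Dx]]; have f'x := Cf' _ Cx.
  by split=> //; split; [exact: fun_f'|rewrite -eqC //; exact: Dg'].
- by move=> x [Cx [fx Dx]]; rewrite /= -eqC // eqD.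
Qed.

Lemma vi_equiv_fun f g : vi_dom f = vi_dom g ->
  (forall x, vi_dom f x -> vi_fun f x = vi_fun g x) -> vi_equiv f g.
Proof.
move=> eq_dom eq_fun; exists (vi_dom f); split=> //.
- exact: vi_dom_subgroup.
- exact: vi_dom_finite_index.
- by rewrite eq_dom.
Qed.

Lemma vi_compA h g f :
  vi_equiv (vi_comp h (vi_comp g f)) (vi_comp (vi_comp h g) f).
Proof.
apply: vi_equiv_fun => //; apply/seteqP; split=> x /=.
- by move=> [[fx [cx gx]] [_ hx]]; split=> //; split=> //; split=> //; split=> //;
    have [fun_g _ _] := vi_bij g; apply: fun_g.
- move=> [fx [cx [gx [cgx hx]]]]; split; first by split.
  by split=> //; exists (vi_fun f x).
Qed.

Lemma vi_comp1f f : vi_equiv (vi_comp vi_id f) f.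
Proof.
have [fun_f _ _] := vi_bij f; apply: vi_equiv_fun => //.
apply/seteqP; split=> x /=; first by case.
by move=> fx; split=> //; split=> //; exact: fun_f.
Qed.

Lemma vi_compf1 f : vi_equiv (vi_comp f vi_id) f.
Proof.
by apply: vi_equiv_fun => //; apply/seteqP; split=> x /=; [case=> _ []|].
Qed.

Lemma vi_compVf f : vi_equiv (vi_comp (vi_inv f) f) vi_id.
Proof.
exists (vi_dom f); have [fun_f _ _] := vi_bij f; split=> //.
- exact: vi_dom_subgroup.
- exact: vi_dom_finite_index.
- by move=> x fx; split=> //; split; exact: fun_f.
- by move=> x fx; exact: vi_funK.
Qed.

Lemma vi_compfV f : vi_equiv (vi_comp f (vi_inv f)) vi_id.
Proof.
exists (vi_cod f); have [fun_f _ _] := vi_inv_bij f; split=> //.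
- exact: vi_cod_subgroup.
- exact: vi_cod_finite_index.
- by move=> x fx; split=> //; split; exact: fun_f.
- by move=> x fx; exact: vi_inv_funK.
Qed.

End CommensuratorOperations.

Section Commensurator.
Variable G : groupType.

Definition vi_rel (f g : virtual_iso G) : bool := `[< vi_equiv f g >].

Fact vi_rel_equiv : equiv_class_of vi_rel.
Proof.
split=> [f|f g|g f h]; first by apply/asboolP; exact: vi_equiv_refl.
  by apply/asboolP/asboolP; exact: vi_equiv_sym.
by move=> /asboolP fg /asboolP gh; apply/asboolP; exact: vi_equiv_trans gh.
Qed.

Canonical vi_rel_equivRel := EquivRelPack vi_rel_equiv.

Definition Comm : Type := {eq_quot vi_rel}.
HB.instance Definition _ := Choice.on Comm.
HB.instance Definition _ := EqQuotient.on Comm.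

Definition Comm_class (f : virtual_iso G) : Comm := \pi_Comm f.

Lemma Comm_classP f g : reflect (vi_equiv f g) (Comm_class f == Comm_class g).
Proof. by rewrite /Comm_class eqmodE; apply: asboolP. Qed.

Lemma Comm_classE f g : vi_equiv f g -> Comm_class f = Comm_class g.
Proof. by move=> fg; apply/eqP/Comm_classP. Qed.

Lemma Comm_reprK (c : Comm) : Comm_class (generic_quotient.repr c) = c.
Proof. exact: reprK. Qed.

Lemma Comm_class_repr f :
  vi_equiv (generic_quotient.repr (Comm_class f)) f.
Proof. by apply/Comm_classP; rewrite Comm_reprK. Qed.

(* [psi] * [phi] is the class of phi followed by psi. *)
Definition Comm_mul (c e : Comm) : Comm :=
  Comm_class (vi_comp (generic_quotient.repr c) (generic_quotient.repr e)).

Definition Comm_one : Comm := Comm_class (vi_id G).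

Definition Comm_inv (c : Comm) : Comm :=
  Comm_class (vi_inv (generic_quotient.repr c)).

Lemma Comm_mulE f g :
  Comm_mul (Comm_class f) (Comm_class g) = Comm_class (vi_comp f g).
Proof.
by apply: Comm_classE; apply: vi_equiv_comp; exact: Comm_class_repr.
Qed.

Fact Comm_mulA : associative Comm_mul.
Proof.
move=> a b c; rewrite -(Comm_reprK a) -(Comm_reprK b) -(Comm_reprK c).
by rewrite !Comm_mulE; apply: Comm_classE; exact: vi_compA.
Qed.

Fact Comm_mul1 : left_id Comm_one Comm_mul.
Proof.
move=> a; rewrite -(Comm_reprK a) Comm_mulE.
by apply: Comm_classE; exact: vi_comp1f.
Qed.

Fact Comm_mulr1 : right_id Comm_one Comm_mul.
Proof.
move=> a; rewrite -(Comm_reprK a) Comm_mulE.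
by apply: Comm_classE; exact: vi_compf1.
Qed.

Fact Comm_mulV : left_inverse Comm_one Comm_inv Comm_mul.
Proof.
move=> a; rewrite -[X in Comm_mul _ X]Comm_reprK Comm_mulE.
by apply: Comm_classE; exact: vi_compVf.
Qed.

Fact Comm_mulrV : right_inverse Comm_one Comm_inv Comm_mul.
Proof.
move=> a; rewrite -[X in Comm_mul X _]Comm_reprK Comm_mulE.
by apply: Comm_classE; exact: vi_compfV.
Qed.

HB.instance Definition _ := isGroup.Build Comm
  Comm_mulA Comm_mul1 Comm_mulr1 Comm_mulV Comm_mulrV.

End Commensurator.

Section CompositionFactors.
Context {G : groupType}.

(* (s l, s l.-1, ..., s 0) is a composition series going from A to G. *)
Definition composition_series (A : set G) (l : nat) (s : nat -> set G) : Prop :=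
  [/\ s 0 = setT, s l = A &
      forall i, (i < l)%N -> normal_subgroup (s i.+1) (s i) /\
        exists S : FS, quotient_iso (s i) (s i.+1) (FSgroup S)].

Definition factor_count (S : FS) (l : nat) (s : nat -> set G) : nat :=
  #|[pred i : 'I_l | `[< quotient_iso (s i) (s i.+1) (FSgroup S) >]]|.

(* n_S^G(A); by Jordan-Hoelder all the composition series from A to G yield   *)
(* the same count.                                                            *)
Definition factor_mult (S : FS) (A : set G) : nat :=
  xget 0%N [set k | exists l s,
    composition_series A l s /\ k = factor_count S l s].

(* d^G; the value at c does not depend on the G-subnormal representative f of *)
(* c that is picked.                                                          *)
Definition comm_d (c : Comm G) : {malg int[FS]} :=
  let f := xget (vi_id G) [set f | vi_subnormal f /\ Comm_class f = c] in
  (\sum_(S \in [set: FS])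
    << (factor_mult S (vi_cod f))%:Z - (factor_mult S (vi_dom f))%:Z *g S >>)%R.

End CompositionFactors.

Local Open Scope ring_scope.

Section FreeAbelian.
Variable V : zmodType.

Definition zlinear_comb (I : choiceType) (b : I -> V) (c : {malg int[I]}) : V :=
  \sum_(i <- msupp c) b i *~ c@_i.

(* c |-> \sum_i c_i b_i is a bijection from the free abelian group Z^(I) onto *)
(* P, that is, P is free abelian with basis b.                                *)
Definition zbasis (P : set V) (I : choiceType) (b : I -> V) : Prop :=
  set_bij setT P (zlinear_comb b).

Definition free_abelian_infinite_rank (P : set V) : Prop :=
  exists (I : choiceType) (b : I -> V), infinite_set [set: I] /\ zbasis P b.

End FreeAbelian.

(* Main.v *)
Require Import Defs.
From HB Require Import structures.
From mathcomp Require Import all_boot all_order all_algebra all_fingroup.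
From mathcomp Require Import all_solvable finmap all_classical.
From mathcomp.multinomials Require Import monalg.

Set Implicit Arguments.
Unset Strict Implicit.
Unset Printing Implicit Defensive.

Import GRing.Theory.
Local Open Scope classical_set_scope.

(** Both inclusions rest on the Schreier index formula: a subgroup of index k
    in a free group of rank r is free of rank k(r - 1) + 1 ([Schreier]).

    Suppose that there is a composition series from the whole group F down to A
    whose factors are listed, with repetitions, in m ([composition_chain]).
    Iterating the index formula along the series, A is free of rank
    P(m)(n - 1) + 1, where P(m) is the product of the orders of the entries of m
    ([chain_orders_prod]).  As n >= 2 and the rank of a free group is an
    isomorphism invariant ([free_on_rank_le]), isomorphic A and B have
    P(mA) = P(mB), which says that d sends the class of an isomorphism A -> B to
    a vector x with prod |S|^(x_S) = 1 ([order_hom_comm_d]).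

    Conversely let x = a - b with a and b two multisets of simple groups such
    that P(a) = P(b).  It is enough to find A and B subnormal whose lists of
    factors are a and b up to a common part: they have the same rank, hence are
    isomorphic, and the common part cancels out in d ([comm_d_onto]).  A free
    group of rank r has a normal subgroup with quotient S as soon as |S| <= r,
    since then the elements of S can be listed as images of the basis
    ([simple_quotient_exists]).  The common part is a series with N factors
    Z/2, which makes the rank larger than any given bound; from there on every
    member of a and of b is available at every step, because the rank never
    decreases ([chain_realize]).

    That d may be computed on any subnormal representative ([comm_d_class])
    comes from the Jordan-Hoelder theorem, applied in the finite quotient of F
    by a normal core: two equivalent representatives agree on some normal
    subgroup K of finite index, and prolonging all the series down to K, or to
    its image, makes them comparable ([vi_equiv_chain]).

    The image is thus the kernel of the morphism from Z^(FS) to the positive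
    rationals that sends delta_S to |S|.  This morphism restricts to an
    isomorphism on the span of the delta_(Z/p), p prime, by unique
    factorisation.  Hence, for S of non prime order, the vectors
    delta_S - sum_p v_p(|S|) delta_(Z/p) form a basis of the kernel
    ([nonprime_zbasis]); there are infinitely many of them, because of the
    alternating groups ([infinite_nonprime_FS]). *)

(** * Morphisms defined on a subgroup *)

Local Open Scope group_scope.

Definition hom_on (G H : groupType) (A : set G) (f : G -> H) : Prop :=
  forall x y, A x -> A y -> f (x * y) = f x * f y.

Section HomOn.
Context {G H : groupType} {A : set G} {f : G -> H}.
Hypotheses (sA : subgroup A) (fM : hom_on A f).

Lemma hom_on1 : f 1 = 1.
Proof. by apply: (mulgI (f 1)); rewrite -fM ?mulg1 //; apply: sA.1. Qed.

Lemma hom_onV x : A x -> f x^-1 = (f x)^-1.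
Proof.
move=> Ax; apply: (mulgI (f x)).
by rewrite -fM ?mulgV ?hom_on1 //; apply: subgroupV.
Qed.

Lemma subgroup_preim (C : set H) : subgroup C -> subgroup (A `&` f @^-1` C).
Proof.
move=> sC; split=> [|x y [Ax Cx] [Ay Cy]]; first by split;
  [apply: sA.1|rewrite /= hom_on1; apply: sC.1].
split; first exact: sA.2.
rewrite /= fM // ?hom_onV //; first exact: sC.2.
exact: subgroupV.
Qed.

(** Equalizers are how a set of generators enters: two morphisms that agree on
    generators of A agree on A. *)
Lemma subgroup_eqhom (g : G -> H) : hom_on A g ->
  subgroup [set x | A x /\ f x = g x].
Proof.
move=> gM; have g1 : g 1 = 1.
  by apply: (mulgI (g 1)); rewrite -gM ?mulg1 //; apply: sA.1.
split=> [|x y [Ax fx] [Ay fy]]; first by split; [apply: sA.1|rewrite hom_on1 g1].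
split; first exact: sA.2.
have AVy := subgroupV sA Ay.
have gV : g y^-1 = (g y)^-1.
  by apply: (mulgI (g y)); rewrite -gM ?mulgV ?g1.
by rewrite fM ?gM // hom_onV // gV fx fy.
Qed.

End HomOn.

(** * Free bases of subgroups *)

(** A basis of the subgroup A of F, seen from inside F: this avoids changing the
    carrier at each step of a series of subgroups.  The third condition, that e
    generates A, stands for the uniqueness part of the universal property. *)
Definition free_on (F : groupType) (A : set F) (I : Type) (e : I -> F) : Prop :=
  [/\ subgroup A, forall i, A (e i),
      forall C, subgroup C -> (forall i, C (e i)) -> A `<=` C &
      forall (H : groupType) (f : I -> H),
        exists g : F -> H, hom_on A g /\ forall i, g (e i) = f i].

Section SubgroupType.
Variables (G : groupType) (A : set G) (sA : subgroup A).

Definition subgroup_pred of subgroup A : pred G := fun x => `[< A x >].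

Lemma subgroup_pred_closed : group_closed (subgroup_pred sA).
Proof.
split=> [|x y]; rewrite !unfold_in; first by apply/asboolP; apply: sA.1.
by move=> /asboolP Ax /asboolP Ay; apply/asboolP; apply: sA.2.
Qed.

HB.instance Definition _ := isMulClosed.Build G (subgroup_pred sA)
  (group_closedM subgroup_pred_closed).
HB.instance Definition _ := isMul1Closed.Build G (subgroup_pred sA)
  subgroup_pred_closed.1.
HB.instance Definition _ := isInvClosed.Build G (subgroup_pred sA)
  (group_closedV subgroup_pred_closed).

Definition subgroup_type := {x : G | subgroup_pred sA x}.
HB.instance Definition _ := SubChoice.on subgroup_type.
HB.instance Definition _ :=
  SubChoice_isSubGroup.Build G (subgroup_pred sA) subgroup_type
    (subgroup_pred_closed).

Lemma subgroup_valM (x y : subgroup_type) :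
  sval (x * y : subgroup_type) = sval x * sval y.
Proof. by []. Qed.

End SubgroupType.

(** If C is a subgroup containing the e_i, then the morphism from F to C that
    fixes them, followed by the inclusion of C into F, is the identity by the
    uniqueness in the universal property; so C = F. *)
Lemma free_basis_on (F : groupType) (I : Type) (e : I -> F) :
  free_basis e -> free_on [set: F] e.
Proof.
move=> free_e; split=> // [C sC Ce x _|H f].
  pose f i : subgroup_type sC := exist _ (e i) (asboolT (Ce i)).
  have [g [[gM ge] _]] := free_e _ f.
  have [id' [_ id_uniq]] := free_e _ e.
  have idE : id' = id by apply: id_uniq.
  have <- : sval (g x) = x; last exact/asboolP/(svalP (g x)).
  suff gE : id' = sval \o g by rewrite -[LHS]/((sval \o g) x) -gE idE.
  apply: id_uniq; split=> [y z|i] /=; last by rewrite ge.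
  by rewrite gM subgroup_valM.
by have [g [[gM ge] _]] := free_e _ f; exists g; split=> // x y _ _.
Qed.

Lemma free_on_eqhom (F H : groupType) (A : set F) (I : Type) (e : I -> F)
    (f g : F -> H) : free_on A e -> hom_on A f -> hom_on A g ->
  (forall i, f (e i) = g (e i)) -> forall x, A x -> f x = g x.
Proof.
move=> [sA Ae genA _] fM gM fge x Ax.
have [] // := genA _ (subgroup_eqhom sA fM gM) _ x Ax.
Qed.

(** * Schreier's theorem *)

(** Pairs (f, s) multiply so that morphisms from A to this group lifting a right
    action of A on X are exactly the cocycles defined below. *)
Definition wreath (H : Type) (X : finType) : Type := ({ffun X -> H} * {perm X})%type.

Section Wreath.
Variables (H : groupType) (X : finType).

HB.instance Definition _ := Choice.on (wreath H X).

Definition wreath_mul (u v : wreath H X) : wreath H X :=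
  ([ffun x => u.1 x * v.1 (u.2 x)], u.2 * v.2).

Definition wreath_one : wreath H X := ([ffun=> 1], 1).

Definition wreath_inv (u : wreath H X) : wreath H X :=
  ([ffun x => (u.1 (u.2^-1 x))^-1], u.2^-1).

Fact wreath_mulA : associative wreath_mul.
Proof.
move=> u v w; congr pair; last exact: mulgA.
by apply/ffunP=> x; rewrite !ffunE /= permM mulgA.
Qed.

Fact wreath_mul1 : left_id wreath_one wreath_mul.
Proof.
case=> f s; congr pair; last exact: mul1g.
by apply/ffunP=> x; rewrite !ffunE /= perm1 mul1g.
Qed.

Fact wreath_mulr1 : right_id wreath_one wreath_mul.
Proof.
case=> f s; congr pair; last exact: mulg1.
by apply/ffunP=> x; rewrite !ffunE /= mulg1.
Qed.

Fact wreath_mulV : left_inverse wreath_one wreath_inv wreath_mul.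
Proof.
move=> u; congr pair; last exact: mulVg.
by apply/ffunP=> x; rewrite !ffunE /= mulVg.
Qed.

Fact wreath_mulrV : right_inverse wreath_one wreath_inv wreath_mul.
Proof.
move=> u; congr pair; last exact: mulgV.
by apply/ffunP=> x; rewrite !ffunE /= permK mulgV.
Qed.

HB.instance Definition _ := isGroup.Build (wreath H X)
  wreath_mulA wreath_mul1 wreath_mulr1 wreath_mulV wreath_mulrV.

End Wreath.

Section Schreier.
Variables (F : groupType) (A : set F) (n : nat) (e : 'I_n -> F).
Hypothesis free_e : free_on A e.
Variables (X : finType) (act : X -> F -> X) (x0 : X).
Hypotheses (act1 : forall x, act x 1 = x).
Hypotheses (actM : forall a b x, A a -> A b -> act x (a * b) = act (act x a) b).
Hypothesis act_trans : forall x, exists2 a, A a & act x0 a = x.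

Let sA : subgroup A. Proof. by case: free_e. Qed.
Let Ae i : A (e i). Proof. by case: free_e. Qed.

(** A cocycle assigns an element of H to each edge x -> x.a of the action
    groupoid, multiplicatively; restricted to the stabiliser of a point, it is a
    morphism. *)
Definition cocycle (H : groupType) (c : F -> X -> H) : Prop :=
  forall a b x, A a -> A b -> c (a * b) x = c a x * c b (act x a).

Lemma actK a x : A a -> act (act x a) a^-1 = x.
Proof. by move=> Aa; rewrite -actM ?mulgV //; apply: subgroupV. Qed.

Lemma actKV a x : A a -> act (act x a^-1) a = x.
Proof. by move=> Aa; rewrite -actM ?mulVg //; apply: subgroupV. Qed.

Lemma act_inj a : A a -> injective (act^~ a).
Proof. by move=> Aa; apply: (can_inj (g := act^~ a^-1)) => x; apply: actK. Qed.

Lemma cocycle1 (H : groupType) (c : F -> X -> H) x : cocycle c -> c 1 x = 1.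
Proof.
move=> cM; have A1 := sA.1.
apply: (mulgI (c 1 x)); have := cM 1 1 x A1 A1.
by rewrite mulg1 act1 => <-; rewrite mulg1.
Qed.

Lemma cocycleV (H : groupType) (c : F -> X -> H) a x :
  cocycle c -> A a -> c a^-1 (act x a) = (c a x)^-1.
Proof.
move=> cM Aa; apply: (mulgI (c a x)).
by rewrite -cM ?mulgV ?cocycle1 //; apply: subgroupV.
Qed.

(** Since A is free, its action lifts to the wreath product with any
    prescribed H-component on each generator: cocycles can be chosen freely on
    the edges (x, i) of the Schreier graph. *)
Lemma cocycle_ext (H : groupType) (f : X -> 'I_n -> H) :
  exists c : F -> X -> H, cocycle c /\ forall i x, c (e i) x = f x i.
Proof.
have [_ _ genA univA] := free_e.
have [g [gM ge]] := univA (wreath H X)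
  (fun i => ([ffun x => f x i], perm (act_inj (Ae i)))).
have g2 a : A a -> forall x, (g a).2 x = act x a.
  move=> Aa; pose D := [set b | A b /\ forall x, (g b).2 x = act x b].
  suff sD : subgroup D.
    by have [] // := genA D sD _ a Aa; move=> i; split=> // x; rewrite ge permE.
  split=> [|b d [Ab gb] [Ad gd]].
    by split=> [|x]; [apply: sA.1|rewrite (hom_on1 sA gM) perm1 act1].
  have AVd := subgroupV sA Ad; split=> [|x]; first exact: sA.2.
  rewrite gM // (hom_onV sA gM) //= permM gb actM //.
  by apply: (@perm_inj _ (g d).2); rewrite permKV gd actKV.
exists (fun a x => (g a).1 x); split=> [a b x Aa Ab|i x].
  by rewrite gM // ffunE g2.
by rewrite ge ffunE.
Qed.

(** A subtree T of the Schreier graph, with vertex set V and root x0, together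
    with the labels t x of the tree paths from x0 to x.  The last field replaces
    a description of these paths: a cocycle that is trivial on the edges of the
    tree is trivial along them. *)
Record spanning_tree (V : {set X}) (T : {set X * 'I_n}) (t : X -> F) : Prop :=
  SpanningTree {
    tree_root : x0 \in V;
    tree_root_path : t x0 = 1;
    tree_card : #|T|.+1 = #|V|;
    tree_path x : x \in V -> A (t x) /\ act x0 (t x) = x;
    tree_edge x i : (x, i) \in T ->
      [/\ x \in V, act x (e i) \in V & t x * e i = t (act x (e i))];
    tree_cocycle (H : groupType) (c : F -> X -> H) : cocycle c ->
      (forall x i, (x, i) \in T -> c (e i) x = 1) ->
      forall x, x \in V -> c (t x) x0 = 1 }.

Lemma spanning_tree_root : spanning_tree [set x0]%SET finset.set0 (fun=> 1).
Proof.
split=> [||||x i|H c cM _ x _]; rewrite ?inE ?cards0 ?cards1 //.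
- by move=> x; rewrite inE => /eqP ->; split; [apply: sA.1|apply: act1].
- exact: cocycle1.
Qed.

(** Adds the leaf y to the tree.  The new edge (z, i) may point either way,
    that is, towards y or away from it. *)
Lemma spanning_tree_add (V : {set X}) T t y t_y z i :
    let t' := fun x => if x == y then t_y else t x in
    spanning_tree V T t -> y \notin V -> A t_y -> act x0 t_y = y ->
    z = y \/ act z (e i) = y -> z \in (y |: V)%SET ->
    act z (e i) \in (y |: V)%SET -> t' z * e i = t' (act z (e i)) ->
    (forall (H : groupType) (c : F -> X -> H), cocycle c ->
       (forall x, x \in V -> c (t x) x0 = 1) -> c (e i) z = 1 -> c t_y x0 = 1) ->
  spanning_tree (y |: V)%SET ((z, i) |: T)%SET t'.
Proof.
move=> t' [Vx0 t1 cT pT eT cocT] Vy At_y act_y zi_y Vz Vzi t_zi coc_y.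
have t'V x : x \in V -> t' x = t x.
  by rewrite /t'; case: eqP => // -> ; rewrite (negPf Vy).
have t'y : t' y = t_y by rewrite /t' eqxx.
have ziT : (z, i) \notin T.
  by apply/negP=> /eT[]; case: zi_y => ->; rewrite (negPf Vy).
split.
- exact: setU1r.
- by rewrite t'V.
- by rewrite !cardsU1 Vy ziT -cT.
- move=> x; rewrite in_setU1 => /predU1P[->|Vx]; first by rewrite t'y.
  by rewrite t'V //; apply: pT.
- move=> x j /setU1P[[-> ->]|/eT[Vx Vxj eq_t]] //.
  by rewrite !in_setU1 Vx Vxj !orbT !t'V.
- move=> H c cM c1.
  have c_t x : x \in V -> c (t x) x0 = 1.
    by apply: cocT => // u j Tuj; apply: c1; exact: setU1r.
  move=> x; rewrite in_setU1 => /predU1P[->|Vx]; last by rewrite t'V ?c_t.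
  by rewrite t'y; apply: (coc_y H c) => //; apply: c1; exact: setU11.
Qed.

(** A proper subset V containing x0 is left by some generator or inverse of a
    generator, for otherwise V would be stable under the transitive action. *)
Lemma spanning_tree_grow (V : {set X}) T t : spanning_tree V T t ->
  V != [set: X]%SET -> exists V' T' t', spanning_tree V' T' t' /\ #|V'| = #|V|.+1.
Proof.
move=> tree VT; have [Vx0 t1 cT pT eT cocT] := tree.
have [[x i] /= Vx] : exists2 xi : X * 'I_n, xi.1 \in V &
    (act xi.1 (e xi.2) \notin V) || (act xi.1 (e xi.2)^-1 \notin V).
  apply/exists_inP; apply: contraT => /exists_inPn stableV.
  have stV x i : x \in V -> act x (e i) \in V /\ act x (e i)^-1 \in V.
    move=> Vx; have := stableV (x, i) Vx; rewrite negb_or !negbK.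
    by move/andP.
  case/negP: VT; rewrite -finset.subTset; apply/fintype.subsetP=> x _.
  have [a Aa <-] := act_trans x; have [_ _ genA _] := free_e.
  pose D := [set b | A b /\ forall x, (act x b \in V) = (x \in V)].
  suff sD : subgroup D.
    have [] // := genA D sD _ a Aa; last by move=> _ ->.
    move=> i; split=> // y; apply/idP/idP=> [|/(stV _ i)[]//].
    by move=> /(stV _ i)[_]; rewrite actK.
  split=> [|b d [Ab bV] [Ad dV]]; first by split=> [|y]; [apply: sA.1|rewrite act1].
  have AVd := subgroupV sA Ad; split=> [|y]; first exact: sA.2.
  by rewrite actM // -dV actKV.
have [At actt] := pT x Vx; have AVe := subgroupV sA (Ae i).
case/orP=> Vy.
  have xy : x == act x (e i) = false by apply/eqP=> xy; rewrite -xy Vx in Vy.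
  exists (act x (e i) |: V)%SET, ((x, i) |: T)%SET,
    (fun z => if z == act x (e i) then t x * e i else t z).
  split; last by rewrite cardsU1 Vy.
  apply: spanning_tree_add => //.
  - exact: subgroupM.
  - by rewrite actM // actt.
  - by right.
  - exact: setU1r.
  - exact: setU11.
  - by rewrite xy eqxx.
  - by move=> H c cM c_t c1; rewrite cM // c_t // actt c1 mulg1.
have xy : x == act x (e i)^-1 = false by apply/eqP=> xy; rewrite -xy Vx in Vy.
exists (act x (e i)^-1 |: V)%SET, ((act x (e i)^-1, i) |: T)%SET,
  (fun z => if z == act x (e i)^-1 then t x * (e i)^-1 else t z).
split; last by rewrite cardsU1 Vy.
apply: spanning_tree_add => //; rewrite ?actKV //.
- exact: subgroupM.
- by rewrite actM // actt.
- by left.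
- exact: setU11.
- exact: setU1r.
- by rewrite eqxx xy mulgVK.
- move=> H c cM c_t c1; rewrite cM // c_t // actt mul1g.
  by rewrite -{1}(actKV x (Ae i)) cocycleV // c1 invg1.
Qed.

Lemma spanning_tree_exists : exists T t, spanning_tree [set: X]%SET T t.
Proof.
suff [V [T [t [tree]]]] : exists V T t, spanning_tree V T t /\ #|V| = #|X|.
  move=> cV; exists T, t; suff <- : V = [set: X]%SET by [].
  by apply/eqP; rewrite eqEcard finset.subsetT cardsT cV leqnn.
suff tree k : (k < #|X|)%N -> exists V T t, spanning_tree V T t /\ #|V| = k.+1.
  have X_gt0 : (0 < #|X|)%N by apply/card_gt0P; exists x0.
  by have := tree #|X|.-1; rewrite prednK //; apply.
elim: k => [_|k IHk ltkX].
  by exists [set x0]%SET, finset.set0, (fun=> 1); split;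
    [exact: spanning_tree_root|rewrite cards1].
have [V [T [t [tree cV]]]] := IHk (ltnW ltkX).
rewrite -cV; apply: spanning_tree_grow tree _.
by apply/eqP=> VT; rewrite VT cardsT in cV; rewrite cV ltnn in ltkX.
Qed.

(** The elements t_x e_i t_y^-1, for (x, i) an edge from x to y outside a
    spanning tree, form a basis of the stabiliser of x0.  They generate because
    the products t_x a t_(x.a)^-1 stay in the subgroup that they generate, and
    they are free because a cocycle that is trivial on the tree takes arbitrary
    values on the other edges.  An action on X has #|X| n edges, of which a
    spanning tree uses #|X| - 1. *)
Theorem Schreier : exists r (e' : 'I_r -> F),
  free_on [set a | A a /\ act x0 a = x0] e' /\ (r + #|X| = #|X| * n + 1)%N.
Proof.
have [T [t [_ t1 cT pT eT cocT]]] := spanning_tree_exists.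
have [_ _ genA _] := free_e.
have At x : A (t x) by have [] := pT x (finset.in_setT x).
have actt x : act x0 (t x) = x by have [] := pT x (finset.in_setT x).
pose gen (xi : X * 'I_n) := t xi.1 * e xi.2 * (t (act xi.1 (e xi.2)))^-1.
have Agen xi : A (gen xi).
  by apply: subgroupM (subgroupV _ _) => //; apply: subgroupM.
have genT xi : xi \in T -> gen xi = 1.
  by case: xi => x i /eT[_ _ eq_t]; rewrite /gen /= eq_t mulgV.
exists #|~: T|%SET, (fun j => gen (enum_val j)); split; last first.
  rewrite cardsCs finset.setCK card_prod card_ord.
  have : (#|T| <= #|X| * n)%N by have := max_card (mem T); rewrite card_prod card_ord.
  rewrite cardsT in cT; move: cT => <- leT.
  by rewrite addnS addn1 subnK.
split.
- split=> [|a b [Aa xa] [Ab xb]] /=; first by rewrite act1; split=> //; apply: sA.1.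
  split; first exact: sA.2.
  rewrite actM ?xa //; last exact: subgroupV.
  by rewrite -{1}xb actK.
- move=> j; split=> //=; rewrite !actM ?actt //; last exact: subgroupV.
    by set y := act _.1 _; rewrite -{1}(actt y) actK.
  exact: subgroupM.
- move=> C sC Cgen a [Aa ax0].
  have C_gen xi : C (gen xi).
    have [/genT ->|xiT] := boolP (xi \in T); first exact: sC.1.
    rewrite -finset.in_setC in xiT.
    by have := Cgen (enum_rank_in xiT xi); rewrite enum_rankK_in.
  (* D is stable under products since t x * a * b * t_(x.a.b)^-1 splits
     at t_(x.a). *)
  pose D := [set b | A b /\ forall x, C (t x * b * (t (act x b))^-1)].
  suff sD : subgroup D.
    have [|_ /(_ x0)] := genA D sD _ a Aa; last by rewrite ax0 t1 invg1 mulg1 mul1g.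
    by move=> i; split=> // x; apply: (C_gen (x, i)).
  split=> [|b d [Ab Cb] [Ad Cd]].
    split=> [|x]; first exact: sA.1.
    by rewrite act1 mulg1 mulgV; apply: sC.1.
  have AVd := subgroupV sA Ad; split=> [|x]; first exact: sA.2.
  rewrite actM //; set y := act (act x b) d^-1.
  have yd : act y d = act x b by rewrite actKV.
  have := sC.2 _ _ (Cb x) (Cd y); rewrite yd !invgM !invgK.
  by rewrite !mulgA mulgVK.
- move=> H f.
  (* f on the edges outside the tree, 1 on the tree. *)
  pose f' x i := if [pick j | enum_val j == (x, i)] is Some j then f j else 1.
  have [c [cM ce]] := cocycle_ext f'.
  have c_t x : c (t x) x0 = 1.
    apply: cocT => // u i Tui; rewrite ce /f'.
    case: pickP => // j /eqP jui.
    by have := enum_valP j; rewrite jui finset.in_setC Tui.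
  exists (c^~ x0); split=> [a b [Aa xa] [Ab xb]|j]; first by rewrite cM // xa.
  rewrite /gen; have jE : enum_val j = ((enum_val j).1, (enum_val j).2) by case: enum_val.
  set x := (enum_val j).1 in jE *; set i := (enum_val j).2 in jE *.
  have AVt := subgroupV sA (At (act x (e i))).
  have Ate := subgroupM sA (At x) (Ae i).
  rewrite cM // cM // c_t actt mul1g actM // actt ce.
  rewrite -{2}(actt (act x (e i))) cocycleV // c_t invg1 mulg1 /f' -jE.
  case: pickP => [k /eqP/enum_val_inj -> //|/(_ j)]; by rewrite eqxx.
Qed.

End Schreier.

(** * Quotients and ranks *)

Section QuotientIso.
Variables (G : groupType) (A N : set G) (gT : finGroupType) (K : {group gT}).

Definition onto_with_kernel (h : G -> gT) : Prop :=
  [/\ hom_on A h, forall x, A x -> h x \in K,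
      forall k, k \in K -> exists2 x, A x & h x = k &
      forall x, A x -> h x = 1 <-> N x].

(** Trades a bijection on cosets for a morphism defined on the elements of A; in
    the converse direction h is constant on cosets, so any representative does. *)
Lemma quotient_isoP : subgroup A -> subgroup N -> N `<=` A ->
  quotient_iso A N K <-> exists h, onto_with_kernel h.
Proof.
move=> sA sN NA; split=> [[h [[hK h_inj h_surj] hM]]|[h [hM hK h_surj hN]]].
  exists (fun x => h (left_coset x N)).
  have gM : hom_on A (fun x => h (left_coset x N)) by move=> x y; apply: hM.
  split=> //.
  - by move=> x Ax; apply: hK; exists x.
  - by move=> k /h_surj[_ [x Ax <-] <-]; exists x.
  - move=> x Ax; rewrite -(hom_on1 sA gM); split=> [eq_h|Nx].
      have : left_coset x N = left_coset 1 N.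
        apply: h_inj => //; rewrite inE; first by exists x.
        by exists 1; first exact: sA.1.
      have : left_coset x N x by exists 1; [exact: sN.1|rewrite mulg1].
      by move=> + eq_x; rewrite eq_x => -[y Ny <-]; rewrite mul1g.
    congr (h _); apply: left_coset_id => //.
    by rewrite mulg1; apply: subgroupV.
have getE x : A x -> h (xget 1 (left_coset x N)) = h x.
  move=> Ax; have /(xgetPex 1)[y Ny <-] : exists y, left_coset x N y.
    by exists (x * 1); exists 1 => //; apply: sN.1.
  by have Ay := NA y Ny; rewrite hM // (hN y Ay).2 ?mulg1.
exists (fun P => h (xget 1 P)); split; last first.
  by move=> x y Ax Ay; rewrite !getE ?hM //; apply: subgroupM.
split.
- by move=> _ [x Ax <-]; rewrite /= getE //; apply: hK.
- move=> _ _ /set_mem[x Ax <-] /set_mem[y Ay <-]; rewrite !getE // => eq_h.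
  have AVx := subgroupV sA Ax.
  apply: left_coset_id => //; apply/(hN _ (subgroupM sA AVx Ay)).
  by rewrite hM // (hom_onV sA hM) // eq_h mulVg.
- move=> k /h_surj[x Ax <-]; exists (left_coset x N); last exact: getE.
  by exists x.
Qed.

End QuotientIso.

(** N is the stabiliser of 1 in the action of A by right translations on its
    quotient K. *)
Lemma free_on_kernel (F : groupType) (A N : set F) (r : nat) (e : 'I_r -> F)
    (gT : finGroupType) (K : {group gT}) :
  free_on A e -> normal_subgroup N A -> quotient_iso A N K ->
  exists r' (e' : 'I_r' -> F), free_on N e' /\ (r' + #|K| = #|K| * r + 1)%N.
Proof.
move=> free_e [sN sA NA _] /(quotient_isoP K sA sN NA)[h [hM hK h_surj hN]].
have subg1 : subg K 1 = 1 by apply: val_inj; rewrite /= subgK.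
pose act (x : subg_of K) a := x * subg K (h a).
have [||| r' [e']] := @Schreier F A r e free_e (subg_of K) act 1.
- by move=> x; rewrite /act (hom_on1 sA hM) subg1 mulg1.
- by move=> a b x Aa Ab; rewrite /act hM // subgM ?hK // mulgA.
- move=> x; have [a Aa ha] := h_surj _ (subgP x).
  by exists a => //; rewrite /act mul1g ha sgvalK.
have -> : [set a | A a /\ act 1 a = 1] = N.
  apply/seteqP; split=> [a [Aa]|a Na].
    rewrite /act mul1g => /(congr1 sgval); rewrite subgK ?hK // => ha.
    exact/(hN a Aa).
  have Aa := NA a Na; split=> //; rewrite /act mul1g (hN a Aa).2 // subg1.
have -> : #|{: subg_of K}| = #|K| by rewrite -cardsT -(card_isog (isog_subg K)).
by exists r', e'.
Qed.

(** Morphisms from A to a finite group T of order at least 2 are determined by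
    their values on e' and arbitrary on e, so #|T| ^ r <= #|T| ^ r'. *)
Lemma free_on_rank_le (F : groupType) (A : set F) r r' (e : 'I_r -> F)
  (e' : 'I_r' -> F) : free_on A e -> free_on A e' -> (r <= r')%N.
Proof.
move=> free_e free_e'; have [sA Ae' gen_e' _] := free_e'.
have [_ Ae gen_e univ_e] := free_e.
(* The group of order 2 is taken to be {perm bool}. *)
have /choice[g gP] : forall f : {ffun 'I_r -> {perm bool}},
  exists g : F -> {perm bool}, hom_on A g /\ forall i, g (e i) = f i.
  by move=> f; apply: univ_e.
pose phi f := [ffun j => g f (e' j)].
have phi_inj : injective phi.
  move=> f1 f2 /ffunP eq_phi; apply/ffunP=> i.
  have [[g1M <-] [g2M <-]] := (gP f1, gP f2).
  apply: (free_on_eqhom free_e' g1M g2M) => // j.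
  by have := eq_phi j; rewrite !ffunE.
have := leq_card _ phi_inj; rewrite !card_ffun !card_ord.
rewrite leq_exp2l //; apply/card_gt1P; exists 1, (tperm true false); split=> //.
by apply/eqP=> /permP/(_ true); rewrite perm1 tpermL.
Qed.

Lemma free_on_iso (F : groupType) (A B : set F) r (e : 'I_r -> F) (e' : 'I_r -> F) :
  free_on A e -> free_on B e' -> exists f, set_bij A B f /\ hom_on A f.
Proof.
have maps (C D : set F) (u v : 'I_r -> F) : free_on C u -> free_on D v ->
    exists f, [/\ hom_on C f, forall i, f (u i) = v i & forall x, C x -> D (f x)].
  move=> [sC Cu gen_u univ_u] [sD Dv _ _]; have [f [fM fu]] := univ_u F v.
  exists f; split=> // x Cx.
  suff /(gen_u _ (subgroup_preim sC fM sD))/(_ x Cx)[] :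
    forall i, (C `&` f @^-1` D) (u i) by [].
  by move=> i; split; rewrite /= ?fu.
move=> free_e free_e'; have [f [fM fe fA]] := maps _ _ _ _ free_e free_e'.
have [g [gM ge gB]] := maps _ _ _ _ free_e' free_e.
have fK x : A x -> g (f x) = x.
  apply: (free_on_eqhom (f := g \o f) (g := id) free_e) => //.
    by move=> y z Ay Az; rewrite /= fM ?gM //; apply: fA.
  by move=> i; rewrite /= fe ge.
have gK x : B x -> f (g x) = x.
  apply: (free_on_eqhom (f := f \o g) (g := id) free_e') => //.
    by move=> y z Ay Az; rewrite /= gM ?fM //; apply: gB.
  by move=> i; rewrite /= ge fe.
exists f; split=> //; split=> [||y By].
- by move=> x Ax; apply: fA.
- by move=> x y /set_mem Ax /set_mem Ay eq_f; rewrite -(fK x) // eq_f fK.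
- by exists (g y); [apply: gB|apply: gK].
Qed.

(** * Composition chains *)

(** Both simple groups are the image of A under a morphism with kernel N; the
    isomorphism sends f x to g x. *)
Lemma quotient_iso_inj (G : groupType) (A N : set G) (S T : FS) :
  normal_subgroup N A -> quotient_iso A N (FSgroup S) ->
  quotient_iso A N (FSgroup T) -> S = T.
Proof.
move=> [sN sA NA _].
move=> /(quotient_isoP _ sA sN NA)[f [fM fS f_surj fN]].
move=> /(quotient_isoP _ sA sN NA)[g [gM gT g_surj gN]].
apply: FS_inj.
have fg x y : A x -> A y -> f x = f y -> g x = g y.
  move=> Ax Ay eq_f; have AVy := subgroupV sA Ay.
  apply: (mulIg (g y)^-1); rewrite mulgV -(hom_onV sA gM) // -gM //.
  apply/(gN _ (subgroupM sA Ax AVy))/(fN _ (subgroupM sA Ax AVy)).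
  by rewrite fM // (hom_onV sA fM) // eq_f mulgV.
have gf x y : A x -> A y -> g x = g y -> f x = f y.
  move=> Ax Ay eq_g; have AVy := subgroupV sA Ay.
  apply: (mulIg (f y)^-1); rewrite mulgV -(hom_onV sA fM) // -fM //.
  apply/(fN _ (subgroupM sA Ax AVy))/(gN _ (subgroupM sA Ax AVy)).
  by rewrite gM // (hom_onV sA gM) // eq_g mulgV.
pose lift k := xget 1 [set x | A x /\ f x = k].
have liftP k : k \in FSgroup S -> A (lift k) /\ f (lift k) = k.
  by move=> /f_surj[x Ax fx]; apply: (@xgetPex _ 1 [set x | A x /\ f x = k]); exists x.
have phiM : {in FSgroup S &, {morph (g \o lift) : x y / x * y}}.
  move=> x y Sx Sy /=; have [[Ax fx] [Ay fy]] := (liftP x Sx, liftP y Sy).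
  have [Axy fxy] := liftP (x * y) (groupM Sx Sy).
  by rewrite -gM //; apply: fg => //; [apply: subgroupM|rewrite fM // fx fy].
apply/isogP; exists (Morphism phiM) => /=.
  apply/injmP=> x y Sx Sy /= eq_g.
  have [[Ax fx] [Ay fy]] := (liftP x Sx, liftP y Sy).
  by rewrite -fx -fy; apply: gf.
apply/setP=> t; apply/morphimP/idP => [[x _ Sx ->] /=|/[dup] Tt /g_surj[x Ax <-]].
  by apply: gT; have [] := liftP x Sx.
have Sfx := fS x Ax; have [Al fl] := liftP _ Sfx.
by exists (f x) => //=; apply: fg.
Qed.

(** Composition series from B down to A, with the list of their factors.  Unlike
    the indexed series, they start at any subgroup B, so that they can be
    concatenated and carried along isomorphisms. *)
Inductive composition_chain (G : groupType) : set G -> set G -> seq FS -> Prop :=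
| CompositionNil A : subgroup A -> composition_chain A A [::]
| CompositionCons B N A S m : normal_subgroup N B ->
    quotient_iso B N (FSgroup S) -> composition_chain N A m ->
    composition_chain B A (S :: m).

Section Chain.
Context {G : groupType}.
Implicit Types (A B C N : set G) (m : seq FS).

Lemma chain_sub B A m : composition_chain B A m ->
  [/\ subgroup B, subgroup A & A `<=` B].
Proof.
elim=> {B A m} [A sA|B N A S m [sN sB NB _] _ _ [_ sA AN]]; first by split.
by split=> // x /AN /NB.
Qed.

Lemma chain_cat B C A m m' : composition_chain B C m ->
  composition_chain C A m' -> composition_chain B A (m ++ m').
Proof.
move=> chBC chCA; elim: chBC chCA => // {B}{C}{m} B N C S m nNB qBN _ IH /IH.
exact: CompositionCons.
Qed.

Lemma chain_of_series A l s : composition_series A l s ->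
  exists m, composition_chain [set: G] A m /\
            forall S, factor_count S l s = count_mem S m.
Proof.
case=> s0 <-; rewrite -s0 => chs; have : subgroup (s 0) by rewrite s0.
move: chs {s0}; elim: l s => [|l IHl] s chs ss0.
  exists [::]; split; first exact: CompositionNil.
  by move=> S; apply: eq_card0 => -[].
have [nN [S qS]] := chs 0 isT.
have [sN _ _ _] := nN.
have [i lti|//|m [chm cm]] := IHl (s \o succn); first exact: (chs i.+1).
exists (S :: m); split; first exact: CompositionCons qS chm.
move=> T; rewrite /= -cm /factor_count -!sum1_card.
rewrite big_mkcond big_ord_recl [in RHS]big_mkcond /=.
congr (_ + _)%N; rewrite ?unfold_in ?inE /=.
case: asboolP => [qT|nqT]; first by rewrite (quotient_iso_inj nN qS qT) eqxx.
by case: eqP => // eqST; case: nqT; rewrite -eqST.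
Qed.

Lemma series_of_chain A m : composition_chain [set: G] A m ->
  exists l s, composition_series A l s.
Proof.
suff gen B : composition_chain B A m -> exists l s, [/\ s 0 = B, s l = A &
    forall i, (i < l)%N -> normal_subgroup (s i.+1) (s i) /\
        exists S : FS, quotient_iso (s i) (s i.+1) (FSgroup S)].
  exact: gen.
elim=> {B A m} [A _|B N A S m nN qS _ [l [s [s0 sl chs]]]].
  by exists 0, (fun=> A); split.
exists l.+1, (fun i => if i is j.+1 then s j else B); split=> // -[_|i lti].
  by rewrite s0; split=> //; exists S.
exact: chs.
Qed.

Lemma chain_subnormal A m : composition_chain [set: G] A m ->
  subnormal_subgroup A.
Proof.
move=> /series_of_chain[l [s [s0 sl chs]]].
by exists l, s; split=> // i /chs[].
Qed.

Lemma chain_free B A m r (e : 'I_r -> G) : composition_chain B A m ->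
  free_on B e -> exists r' (e' : 'I_r' -> G), free_on A e' /\
    (r' + \prod_(S <- m) FSorder S = (\prod_(S <- m) FSorder S) * r + 1)%N.
Proof.
move=> ch; elim: ch r e => {B A m} [A _|B N A S m nN qS _ IH] r e free_e.
  by exists r, e; rewrite big_nil mul1n.
have [r1 [e1 [free_e1 eq1]]] := free_on_kernel free_e nN qS.
have [r2 [e2 [free_e2 eq2]]] := IH _ _ free_e1.
exists r2, e2; split=> //; rewrite big_cons.
set P := (\prod_(T <- m) FSorder T)%N in eq2 *.
rewrite -/(FSorder S) in eq1.
apply: (@addIn P); rewrite addnAC eq2 addnAC [(_ * P)%N]mulnC -mulnDr eq1.
by rewrite mulnDr muln1 mulnA addnAC.
Qed.

(** An isomorphism between two subgroups carries chains to chains with the same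
    factors, which is why a virtual isomorphism changes the factors below its
    domain only through its domain and codomain. *)
Lemma chain_image (f : G -> G) B A m : composition_chain B A m -> hom_on B f ->
  {in B &, injective f} -> composition_chain (f @` B) (f @` A) m.
Proof.
elim=> {B A m} [A sA|B N A S m [sN sB NB nNB] qS _ IH] fM f_inj.
  by apply: CompositionNil; apply: (subgroup_image sA).
have fMN : hom_on N f by move=> x y /NB Bx /NB By; apply: fM.
have sfN : subgroup (f @` N) by apply: (subgroup_image sN).
have sfB : subgroup (f @` B) by apply: (subgroup_image sB).
have sfNB : f @` N `<=` f @` B by move=> _ [x /NB Bx <-]; exists x.
apply: (@CompositionCons _ _ (f @` N)); last first.
- by apply: IH => // x y /set_mem/NB/mem_set Bx /set_mem/NB/mem_set; apply: f_inj.
- have [h [hM hS h_surj hN]] := (quotient_isoP _ sB sN NB).1 qS.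
  pose finv y := xget 1 [set x | B x /\ f x = y].
  have finvK x : B x -> finv (f x) = x.
    move=> Bx; have [|Bfx ffx] := @xgetPex _ 1 [set z | B z /\ f z = f x].
      by exists x.
    by apply: f_inj => //; apply/mem_set.
  apply/(quotient_isoP _ sfB sfN sfNB); exists (h \o finv); split.
  + move=> _ _ [x Bx <-] [y By <-]; rewrite /= -fM // !finvK //; last exact: subgroupM.
    exact: hM.
  + by move=> _ [x Bx <-]; rewrite /= finvK //; apply: hS.
  + by move=> k /h_surj[x Bx <-]; exists (f x); [exists x|rewrite /= finvK].
  + move=> _ [x Bx <-]; rewrite /= finvK // hN //; split=> [Nx|[y Ny]].
      by exists x.
    have By := NB y Ny.
    by move=> /f_inj <- //; apply/mem_set.
- split=> // _ _ [x Bx <-] [y Ny <-]; exists (y ^ x); first exact: nNB.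
  have By := NB y Ny; have BVx := subgroupV sB Bx.
  rewrite !conjgE !fM ?(hom_onV sB fM) //.
  exact: subgroupM.
Qed.

(** B is covered by finitely many left cosets of A; the representatives for the
    successive quotients are multiplied together. *)
Lemma chain_reps B A m : composition_chain B A m ->
  exists s : seq G, forall b, B b -> exists2 x, x \in s & A (x^-1 * b).
Proof.
elim=> {B A m} [A sA|B N A S m [sN sB NB _] qS _ [s sP]].
  by exists [:: 1] => b Ab; exists 1; rewrite ?inE // invg1 mul1g.
have [h [hM hS h_surj hN]] := (quotient_isoP _ sB sN NB).1 qS.
pose rep k := xget 1 [set x | B x /\ h x = k].
exists [seq rep k * x | k <- enum (FSgroup S), x <- s] => b Bb.
have [|Br hr] := @xgetPex _ 1 [set x | B x /\ h x = h b]; first by exists b.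
have BVr := subgroupV sB Br.
have /sP[x sx Ax] : N ((rep (h b))^-1 * b).
  apply/(hN _ (subgroupM sB BVr Bb)).
  by rewrite hM // (hom_onV sB hM) // hr mulVg.
exists (rep (h b) * x); last by rewrite invgM -mulgA.
by apply/allpairsP; exists (h b, x); rewrite mem_enum hS.
Qed.

Lemma chain_finite_index A m : composition_chain [set: G] A m -> finite_index A.
Proof.
move=> ch; have [_ sA _] := chain_sub ch; have [s sP] := chain_reps ch.
apply: (@sub_finite_set _ _ ((fun x => left_coset x A) @` [set` s])).
  move=> _ [b _ <-]; have [x sx Axb] := sP b I.
  by exists x => //; apply: left_coset_id.
exact/finite_image/finite_seq.
Qed.

End Chain.

(** * Composition chains in a finite quotient *)

Section FiniteQuotient.
Variables (G : groupType) (gT : finGroupType) (rho : G -> gT).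
Hypothesis rhoM : {morph rho : x y / x * y}.
Implicit Types (A B N : set G).

Let rho_hom A : hom_on A rho. Proof. by move=> x y _ _; apply: rhoM. Qed.
Let rho1 : rho 1 = 1. Proof. exact: (hom_on1 subgroupT (@rho_hom setT)). Qed.
Let rhoV x : rho x^-1 = (rho x)^-1.
Proof. exact: (hom_onV subgroupT (@rho_hom setT)). Qed.

(** Written as a generated group so that it is defined for every set A; for a
    subgroup A it is the image of A, see [imgP]. *)
Definition img A : {group gT} := <<[set y | `[< (rho @` A) y >]]%SET>>%G.

Lemma imgP A y : subgroup A -> reflect (exists2 x, A x & rho x = y) (y \in img A).
Proof.
move=> sA; set R := [set y | `[< (rho @` A) y >]]%SET.
have RP z : reflect (exists2 x, A x & rho x = z) (z \in R).
  by rewrite finset.inE; apply: asboolP.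
suff gR : group_set R.
  by have imgE : img A = R :> {set gT} := genGid (group gR); rewrite imgE.
apply/group_setP; split; first by apply/RP; exists 1 => //; apply: sA.1.
move=> u v /RP[x Ax <-] /RP[z Az <-]; apply/RP.
by exists (x * z) => //; apply: subgroupM.
Qed.

Lemma mem_img A x : subgroup A -> A x -> rho x \in img A.
Proof. by move=> sA Ax; apply/imgP => //; exists x. Qed.

Lemma mem_img_inv A x : subgroup A -> (forall z, rho z = 1 -> A z) ->
  rho x \in img A -> A x.
Proof.
move=> sA kerA /(imgP _ sA)[z Az eq_zx].
rewrite -(mulVKg z x); apply: subgroupM => //.
by apply: kerA; rewrite rhoM rhoV eq_zx mulVg.
Qed.

Lemma img_sub A B : subgroup A -> subgroup B -> A `<=` B -> img A \subset img B.
Proof.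
move=> sA sB AB; apply/fintype.subsetP=> _ /(imgP _ sA)[x Ax <-].
by apply: mem_img => //; apply: AB.
Qed.

Lemma img_normal N A : normal_subgroup N A -> img N <| img A.
Proof.
move=> [sN sA NA nNA]; rewrite /normal img_sub //=.
apply/fintype.subsetP=> _ /(imgP _ sA)[x Ax <-]; rewrite inE.
apply/fintype.subsetP=> _ /imsetP[_ /(imgP _ sN)[y Ny <-] ->].
rewrite conjgE -rhoV -!rhoM; apply: mem_img => //; exact: nNA.
Qed.

Lemma img_quotient_isog N A (hT : finGroupType) (K : {group hT}) :
  normal_subgroup N A -> (forall z, rho z = 1 -> N z) -> quotient_iso A N K ->
  img A / img N \isog K.
Proof.
move=> nN kerN qK; have [sN sA NA _] := nN.
have [h [hM hK h_surj hN]] := (quotient_isoP _ sA sN NA).1 qK.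
pose lift k := xget 1 [set x | A x /\ rho x = k].
have liftP k : k \in img A -> A (lift k) /\ rho (lift k) = k.
  move=> /(imgP _ sA)[x Ax rx].
  by apply: (@xgetPex _ 1 [set x | A x /\ rho x = k]); exists x.
have h_rho x y : A x -> A y -> rho x = rho y -> h x = h y.
  move=> Ax Ay eq_r; have AVy := subgroupV sA Ay.
  apply: (mulIg (h y)^-1); rewrite mulgV -(hom_onV sA hM) // -hM //.
  apply/(hN _ (subgroupM sA Ax AVy))/kerN.
  by rewrite rhoM rhoV eq_r mulgV.
have phiM : {in img A &, {morph (h \o lift) : x y / x * y}}.
  move=> x y Sx Sy /=; have [[Ax fx] [Ay fy]] := (liftP x Sx, liftP y Sy).
  have [Axy fxy] := liftP (x * y) (groupM Sx Sy).
  by rewrite -hM //; apply: h_rho => //; [apply: subgroupM|rewrite rhoM fx fy].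
pose phi := Morphism phiM.
have phi_rho x : A x -> phi (rho x) = h x.
  move=> Ax; have [Al rl] := liftP _ (mem_img sA Ax); exact: h_rho.
have <- : 'ker phi = img N.
  apply/setP=> y; apply/idP/(imgP _ sN) => [ker_y|[x Nx <-]].
    have /(imgP _ sA)[x Ax rx] := dom_ker ker_y; exists x => //.
    by apply/(hN x Ax); rewrite -phi_rho // rx; apply: mker.
  have Ax := NA x Nx; apply/kerP; first exact: mem_img.
  by rewrite phi_rho //; apply/hN.
suff <- : phi @* img A = K by apply: first_isog.
apply/setP=> t; apply/morphimP/idP => [[x _ Ax ->] /=|/h_surj[x Ax <-]].
  by apply: hK; have [] := liftP x Ax.
by exists (rho x); rewrite ?phi_rho ?mem_img.
Qed.

(** The multiplicity of S in the composition series of a finite group, computed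
    on one series that goes down to 1. *)
Definition simple_mult (S : FS) (H : {group gT}) : nat :=
  count (fun s : section gT => s \isog FSgroup S)
    (mkfactors H (xchoose (exists_comps H))).

(** This is where the Jordan-Hoelder theorem is used: the series of H may be
    taken to go through M. *)
Lemma simple_mult_maxnormal (S : FS) (H M : {group gT}) : maxnormal M H H ->
  simple_mult S H = ((H / M \isog FSgroup S)%g + simple_mult S M)%N.
Proof.
move=> maxM; set s := xchoose (exists_comps M).
have compsH : comps H (M :: s).
  by have /andP[ls cs] := xchooseP (exists_comps M); apply/and3P.
rewrite /simple_mult.
have /seq.permP-> := JordanHolderUniqueness (xchooseP (exists_comps H)) compsH.
rewrite /=; congr (_ + _)%N; congr nat_of_bool.
exact: (isog_transl _ (section_reprP (mkSec H M))).
Qed.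

(** Above the kernel of rho, a chain has the same quotients as its image, so its
    factors are counted by the additive invariant [simple_mult]. *)
Lemma chain_simple_mult B A m : composition_chain B A m ->
  (forall z, rho z = 1 -> A z) ->
  forall S, simple_mult S (img B) = (count_mem S m + simple_mult S (img A))%N.
Proof.
move=> ch; elim: ch => {B A m} [//|B N A S m nN qS chNA IH] kerA T.
have [_ _ AN] := chain_sub chNA.
have kerN z : rho z = 1 -> N z by move=> /kerA/AN.
have isoS := img_quotient_isog nN kerN qS.
rewrite (@simple_mult_maxnormal _ _ (img N)); last first.
  by rewrite -quotient_simple ?img_normal // (isog_simple isoS) FS_simple.
rewrite (isog_transl _ isoS) IH //= addnA; congr (_ + _ + _)%N.
congr nat_of_bool; apply/idP/eqP=> [/FS_inj //|->]; exact: isog_refl.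
Qed.

(** Pull back to B a composition series of the finite group rho(B) refining
    rho(N): take a maximal normal subgroup of rho(B) containing rho(N), and
    recurse on the order. *)
Lemma chain_exists N B : normal_subgroup N B -> (forall z, rho z = 1 -> N z) ->
  exists m, composition_chain B N m.
Proof.
move=> nN kerN; have [k] := ubnP #|img B|; elim: k B nN => // k IHk B nN ltBk.
have [sN sB NB nNB] := nN.
have [eqBN|neqBN] := eqVneq (img N : {set gT}) (img B).
  exists [::]; suff -> : B = N by apply: CompositionNil.
  apply/seteqP; split=> // x Bx; apply: mem_img_inv => //.
  by rewrite eqBN mem_img.
have nimg := img_normal nN.
have [] := @maxgroup_exists gT
  (fun M : {group gT} => (M \proper img B) && (img B \subset 'N(M))) (img N).
  by rewrite (normal_norm nimg) finset.properEneq neqBN (normal_sub nimg).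
move=> M maxM sNM.
have ltMB : M \proper img B by have /maxgroupp/andP[] := maxM.
have nMB : M <| img B by have /maxgroupp/andP[? ?] := maxM; rewrite /normal proper_sub.
have simBM : simple (img B / M) by rewrite quotient_simple.
have [S isoS] := FS_surj simBM.
pose C := [set b | B b /\ rho b \in M].
have sC : subgroup C.
  split=> [|x y [Bx Mx] [By My]]; first by split; [apply: sB.1|rewrite rho1 group1].
  by split; [apply: sB.2|rewrite rhoM rhoV groupM ?groupV].
have CB : C `<=` B by move=> x [].
have NC : N `<=` C.
  by move=> x Nx; split; [apply: NB|apply: (fintype.subsetP sNM); apply: mem_img].
have nC : normal_subgroup C B.
  split=> // x y Bx [By My]; split.
    by rewrite conjgE; apply: subgroupM; [|apply: subgroupV|apply: subgroupM].
  rewrite conjgE !rhoM rhoV -conjgE memJ_norm //.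
  by apply: (fintype.subsetP (normal_norm nMB)); apply: mem_img.
have nNC : normal_subgroup N C by split=> // x y [Bx _]; apply: nNB.
have imgC : img C = M.
  apply/val_inj/setP => y; apply/(imgP _ sC)/idP => [[x [_ Mx] <-] //|My].
  have /(imgP _ sB)[x Bx rx] := fintype.subsetP (normal_sub nMB) y My.
  by exists x => //; split; rewrite ?rx.
have [|m chm] := IHk C nNC.
  by rewrite imgC; apply: leq_trans (proper_card ltMB) _.
exists (S :: m); apply: CompositionCons nC _ chm.
apply/(quotient_isoP _ sB sC CB).
have /isogP[f injf imf] := isoS.
have norm_rho b : B b -> rho b \in 'N(M).
  by move=> Bb; apply: (fintype.subsetP (normal_norm nMB)); apply: mem_img.
have quo_rho b : B b -> coset M (rho b) \in img B / M.
  by move=> Bb; apply: mem_quotient; apply: mem_img.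
exists (fun b => f (coset M (rho b))); split.
- by move=> x y Bx By; rewrite rhoM !morphM ?norm_rho ?quo_rho.
- by move=> x Bx; rewrite -imf mem_morphim ?quo_rho.
- move=> y; rewrite -imf => /morphimP[_ _ /morphimP[z Nz Bz ->] ->].
  by have /(imgP _ sB)[x Bx rx] := Bz; exists x; rewrite ?rx.
- move=> x Bx; split=> [/eqP|[_ Mx]]; last by rewrite coset_id ?morph1.
  rewrite morph_injm_eq1 ?quo_rho // => /eqP cx1; split=> //.
  by apply: coset_idr => //; apply: norm_rho.
Qed.

End FiniteQuotient.

(** * Independence of the representative *)

Lemma mcoeff_sum_malgU (I : choiceType) (a : I -> int) (E : {fset I}) (i : I) :
  ((\sum_(j <- E) << a j *g j >>)@_i = if i \in E then a i else 0)%R.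
Proof.
rewrite raddf_sum /=; under eq_bigr do rewrite mcoeffU.
have [iE|niE] := boolP (i \in E).
  rewrite (bigD1_seq i) ?fset_uniq //= eqxx mulr1n big1 ?addr0 // => j ji.
  by rewrite (negPf ji) mulr0n.
rewrite big1_seq // => j /andP[_ jE].
by have [ji|_] := eqVneq j i; [rewrite -ji jE in niE|rewrite mulr0n].
Qed.

Section Core.
Variable G : groupType.
Implicit Types (A B C : set G) (m : seq FS).

Lemma left_coset_translate x y A :
  left_coset (x * y) A = (fun z => x * z) @` left_coset y A.
Proof.
apply/seteqP; split=> [_ [a Aa <-]|_ [_ [a Aa <-] <-]].
  by exists (y * a); [exists a|rewrite mulgA].
by exists a; rewrite ?mulgA.
Qed.

(** F acts on the finite set of left cosets of A, and whatever acts trivially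
    fixes the coset A. *)
Lemma finite_index_core A : subgroup A -> finite_index A ->
  exists (gT : finGroupType) (rho : G -> gT),
    {morph rho : x y / x * y} /\ forall x, rho x = 1 -> A x.
Proof.
move=> sA fA; pose X := fset_set (left_cosets setT A).
have XP P : P \in X = (P \in left_cosets setT A) by rewrite in_fset_set.
have tr_subproof x (P : X) : (fun z => x * z) @` (val P : set G) \in X.
  rewrite XP; have := valP P; rewrite XP => /set_mem[y _ <-].
  by apply/mem_set; exists (x * y) => //; apply: left_coset_translate.
pose tr x P : X := [` tr_subproof x P]%fset.
have trM x y P : tr (x * y) P = tr x (tr y P).
  apply: val_inj => /=; apply/seteqP; split=> [_ [z Pz <-]|_ [_ [z Pz <-] <-]].
    by exists (y * z); [exists z|rewrite mulgA].
  by exists z; rewrite ?mulgA.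
have tr1 P : tr 1 P = P.
  apply: val_inj => /=; apply/seteqP; split=> [_ [z Pz <-]|z Pz].
    by rewrite mul1g.
  by exists z; rewrite ?mul1g.
have tr_inj x : injective (tr x).
  by apply: (can_inj (g := tr x^-1)) => P; rewrite -trM mulVg tr1.
(* Permutations compose from left to right, hence the inverse. *)
pose rho x := perm (@tr_inj x^-1); exists {perm X}, rho; split=> [x y|x /permP].
  by apply/permP=> P; rewrite permM !permE invgM trM.
have XA : left_coset 1 A \in X by rewrite XP; apply/mem_set; exists 1.
move=> /(_ [` XA]%fset); rewrite permE perm1 => /(congr1 val) /= trA.
have [z [a Aa <-]] : ((fun z => x^-1 * z) @` left_coset 1 A) 1.
  by rewrite trA; exists 1; [apply: sA.1|rewrite mulg1].
rewrite mul1g => xa1; suff -> : x = a by [].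
by rewrite -[a](mulVKg x) xa1 mulg1.
Qed.

Lemma chain_unique A m m' : composition_chain [set: G] A m ->
  composition_chain [set: G] A m' -> perm_eq m m'.
Proof.
move=> ch ch'; have [_ sA _] := chain_sub ch.
have [gT [rho [rhoM kerA]]] := finite_index_core sA (chain_finite_index ch).
(* Both counts differ from the multiplicity in the image of G by the
   multiplicity in the image of A. *)
apply/allP => S _ /=; rewrite -(eqn_add2r (simple_mult S (img rho A))).
by rewrite -(chain_simple_mult rhoM ch kerA) -(chain_simple_mult rhoM ch' kerA).
Qed.

Lemma subnormal_chain A : subgroup A -> finite_index A -> subnormal_subgroup A ->
  exists m, composition_chain [set: G] A m.
Proof.
move=> sA fA [l [s [s0 sl ns]]].
have [gT [rho [rhoM kerA]]] := finite_index_core sA fA.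
(* The whole series lies above A, hence above the kernel of rho. *)
have sub_s i : (i <= l)%N -> A `<=` s (l - i)%N.
  elim: i => [_|i IHi ltil]; first by rewrite subn0 sl.
  apply: (subset_trans (IHi (ltnW ltil))).
  have lt : (l - i.+1 < l)%N by rewrite ltn_subrL; case: (l) ltil.
  by have [_ _ + _] := ns _ lt; rewrite subnSK.
have ker_s i : (i <= l)%N -> forall z, rho z = 1 -> s i z.
  by move=> leil z /kerA; rewrite -(subKn leil); apply: sub_s; apply: leq_subr.
suff [m chm] : exists m, composition_chain [set: G] (s l) m by exists m; rewrite -sl.
elim: {-2}l (leqnn l) => [_|i IHi ltil].
  by exists [::]; rewrite s0; apply: CompositionNil.
have [m chm] := IHi (ltnW ltil).
have [m' chm'] := chain_exists rhoM (ns i ltil) (ker_s _ ltil).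
by exists (m ++ m'); apply: chain_cat chm'.
Qed.

Lemma factor_multE A m : composition_chain [set: G] A m ->
  forall S, factor_mult S A = count_mem S m.
Proof.
move=> ch S; rewrite /factor_mult; have [l [s ss]] := series_of_chain ch.
have [|l' [s' [ss' ->]]] := @xgetPex _ 0%N [set k | exists l s,
    composition_series A l s /\ k = factor_count S l s].
  by exists (factor_count S l s), l, s.
have [m' [ch' ->]] := chain_of_series ss'.
by have /seq.permP -> := chain_unique ch' ch.
Qed.

(** Let K be a normal subgroup of finite index of the whole group on which f and
    g agree.  The chains to the two domains can be prolonged to K, those to the
    two codomains to f(K) = g(K), with the same new factors on both sides;
    chains with the same end have the same factors. *)
Lemma vi_equiv_chain (f g : virtual_iso G) mf mf' mg mg' : vi_equiv f g ->
  composition_chain setT (vi_dom f) mf -> composition_chain setT (vi_cod f) mf' ->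
  composition_chain setT (vi_dom g) mg -> composition_chain setT (vi_cod g) mg' ->
  perm_eq (mf' ++ mg) (mg' ++ mf).
Proof.
move=> [C [sC fC Cf Cg eq_fg]] chf chf' chg chg'.
have [gT [rho [rhoM kerC]]] := finite_index_core sC fC.
pose K := [set x | rho x = 1].
have rho1 : rho 1 = 1.
  by apply: (mulgI (rho 1)); rewrite -rhoM !mulg1.
have rhoV x : rho x^-1 = (rho x)^-1.
  by apply: (mulgI (rho x)); rewrite -rhoM !mulgV.
have sK : subgroup K.
  by split=> [//|x y Kx Ky]; rewrite /K /= rhoM rhoV Kx Ky invg1 mulg1.
have extend (h : virtual_iso G) mh mh' : K `<=` vi_dom h ->
    composition_chain setT (vi_dom h) mh -> composition_chain setT (vi_cod h) mh' ->
    exists k, composition_chain setT K (mh ++ k) /\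
              composition_chain setT (vi_fun h @` K) (mh' ++ k).
  move=> Kh chh chh'; have [_ h_inj h_surj] := vi_bij h.
  have nK : normal_subgroup K (vi_dom h).
    split=> // [|x y hx Ky]; first exact: vi_dom_subgroup.
    by rewrite /K /= conjgE !rhoM rhoV Ky mul1g mulVg.
  have [k chk] := chain_exists rhoM nK (fun z => id).
  exists k; split; first exact: chain_cat chk.
  apply: chain_cat chh' _.
  have <- : vi_fun h @` vi_dom h = vi_cod h.
    by apply/seteqP; split=> // _ [x hx <-]; have [fun_h _ _] := vi_bij h; apply: fun_h.
  exact: chain_image chk (@vi_morph _ h) h_inj.
have KC : K `<=` C by move=> x; apply: kerC.
have [k [chKf chKf']] := extend f _ _ (subset_trans KC Cf) chf chf'.
have [k' [chKg chKg']] := extend g _ _ (subset_trans KC Cg) chg chg'.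
have eqK : vi_fun f @` K = vi_fun g @` K.
  by apply/seteqP; split=> _ [x Kx <-]; exists x; rewrite // eq_fg //; apply: KC.
rewrite eqK in chKf'.
have /seq.permP eq1 := chain_unique chKf chKg.
have /seq.permP eq2 := chain_unique chKf' chKg'.
apply/seq.permP => p; have := eq1 p; have := eq2 p; rewrite !count_cat => e2 e1.
apply/eqP; rewrite -(eqn_add2r (count p k + count p k')).
by rewrite addnACA e2 -e1 addnACA [(count p k' + _)%N]addnC.
Qed.

Local Open Scope ring_scope.

Lemma comm_d_coef (c : Comm G) (f : virtual_iso G) mf mf' :
  f = xget (vi_id G) [set f | vi_subnormal f /\ Comm_class f = c] ->
  composition_chain setT (vi_dom f) mf -> composition_chain setT (vi_cod f) mf' ->
  forall S, (comm_d c)@_S = (count_mem S mf')%:Z - (count_mem S mf)%:Z.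
Proof.
move=> deff chf chf' S; rewrite /comm_d -deff.
pose a T : int := (count_mem T mf')%:Z - (count_mem T mf)%:Z.
rewrite (eq_fsbigr (fun T => << a T *g T >>)); last first.
  by move=> T _; rewrite (factor_multE chf) (factor_multE chf').
have a0 T : T \notin mf' ++ mf -> a T = 0.
  rewrite mem_cat negb_or => /andP[/count_memPn Tf' /count_memPn Tf].
  by rewrite /a Tf Tf'.
pose E : {fset FS} := seq_fset tt (mf' ++ mf).
have EP T : (T \in E) = (T \in mf' ++ mf) by apply: seq_fsetE.
rewrite (fsbigTE E); last by move=> T; rewrite EP => /a0 ->; exact: monalgU0.
rewrite -[RHS]/(a S) (mcoeff_sum_malgU a).
by case: ifP => //; rewrite EP => /negbT/a0.
Qed.

Lemma comm_d_class (f : virtual_iso G) mf mf' :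
  composition_chain setT (vi_dom f) mf -> composition_chain setT (vi_cod f) mf' ->
  forall S, (comm_d (Comm_class f))@_S = (count_mem S mf')%:Z - (count_mem S mf)%:Z.
Proof.
move=> chf chf' S.
set g := xget (vi_id G) [set g | vi_subnormal g /\ Comm_class g = Comm_class f].
have [[dom_g cod_g] gf] : vi_subnormal g /\ Comm_class g = Comm_class f.
  apply: (@xgetPex _ (vi_id G) [set g | vi_subnormal g /\ Comm_class g = Comm_class f]).
  by exists f; split=> //; split; apply: chain_subnormal; eassumption.
have [mg chg] := subnormal_chain (vi_dom_subgroup g) (vi_dom_finite_index g) dom_g.
have [mg' chg'] := subnormal_chain (vi_cod_subgroup g) (vi_cod_finite_index g) cod_g.
rewrite (comm_d_coef (erefl g) chg chg').
have /Comm_classP equiv_gf : Comm_class g == Comm_class f by apply/eqP.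
have /seq.permP/(_ (pred1 S)) := vi_equiv_chain equiv_gf chg chg' chf chf'.
rewrite !count_cat => eqS; apply/eqP; rewrite subr_eq addrAC eq_sym subr_eq.
by rewrite -!PoszD eqS.
Qed.

Lemma comm_d_representative (c : Comm G) : exists (f : virtual_iso G) mf mf',
  [/\ composition_chain setT (vi_dom f) mf, composition_chain setT (vi_cod f) mf' &
  forall S, (comm_d c)@_S = (count_mem S mf')%:Z - (count_mem S mf)%:Z].
Proof.
set f := xget (vi_id G) [set f | vi_subnormal f /\ Comm_class f = c].
have [dom_f cod_f] : vi_subnormal f.
  rewrite /f; case: xgetP => [g _ []//|_].
  by split; exists 0, (fun=> setT); split.
have [mf chf] := subnormal_chain (vi_dom_subgroup f) (vi_dom_finite_index f) dom_f.
have [mf' chf'] := subnormal_chain (vi_cod_subgroup f) (vi_cod_finite_index f) cod_f.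
by exists f, mf, mf'; split=> //; apply: comm_d_coef.
Qed.

End Core.

(** * The product of the orders *)

Local Open Scope ring_scope.

Definition orders_prod (m : seq FS) : nat := (\prod_(S <- m) FSorder S)%N.

Lemma FSorder_gt0 S : (0 < FSorder S)%N.
Proof. exact: cardG_gt0. Qed.

Lemma orders_prod_gt0 m : (0 < orders_prod m)%N.
Proof. by apply: prodn_gt0 => S; apply: FSorder_gt0. Qed.

Definition formal_sum (m : seq FS) : {malg int[FS]} := \sum_(S <- m) << 1 *g S >>.

Lemma formal_sum_coef m S : (formal_sum m)@_S = (count_mem S m)%:Z.
Proof.
rewrite /formal_sum; elim: m => [|T m IH]; first by rewrite big_nil mcoeff0.
by rewrite big_cons mcoeffD IH mcoeffU /= PoszD; congr (_ + _); case: eqP.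
Qed.

Lemma formal_sum_cat m m' : formal_sum (m ++ m') = formal_sum m + formal_sum m'.
Proof. exact: big_cat. Qed.

Lemma formal_sum_nseq S k : formal_sum (nseq k S) = << k%:Z *g S >>.
Proof.
apply/malgP => T; rewrite formal_sum_coef count_nseq mcoeffU /=.
by case: eqP; rewrite ?mul1n ?mul0n ?mulr1n ?mulr0n.
Qed.

(** Separates positive and negative coefficients, so that an equation
    prod |S|^(x_S) = 1 becomes an equality of natural numbers. *)
Lemma malg_formal_sums (x : {malg int[FS]}) :
  exists a b, x = formal_sum a - formal_sum b.
Proof.
rewrite [x]monalgE.
apply: (big_ind (fun y => exists a b, y = formal_sum a - formal_sum b)).
- by exists [::], [::]; rewrite subrr.
- move=> _ _ [a [b ->]] [c [d ->]]; exists (a ++ c), (b ++ d).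
  by rewrite !formal_sum_cat opprD addrACA.
- move=> S _; case: (x@_S) => k.
    by exists (nseq k S), [::]; rewrite formal_sum_nseq /formal_sum big_nil subr0.
  exists [::], (nseq k.+1 S).
  by rewrite formal_sum_nseq /formal_sum big_nil sub0r NegzE monalgUN.
Qed.

(** The morphism from Z^(FS) to the multiplicative group of rationals sending
    delta_S to the order of S. *)
Definition order_hom (x : {malg int[FS]}) : rat :=
  \prod_(S <- msupp x) (FSorder S)%:R ^ x@_S.

Lemma order_homEw (d : {fset FS}) x : (msupp x `<=` d)%fset ->
  order_hom x = \prod_(S <- d) (FSorder S)%:R ^ x@_S.
Proof.
move=> le; rewrite /order_hom (big_fset_incl _ le) => //= S Sd.
by move=> /mcoeff_outdom ->; rewrite expr0z.
Qed.

Lemma FSorder_neq0 S : (FSorder S)%:R != 0 :> rat.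
Proof. by rewrite Num.Theory.pnatr_eq0 -lt0n FSorder_gt0. Qed.

Lemma order_homB x y : order_hom (x - y) = order_hom x / order_hom y.
Proof.
pose d := (msupp x `|` msupp y)%fset.
rewrite (@order_homEw d) ?msuppB_le // (@order_homEw d x) ?fsubsetUl //.
rewrite (@order_homEw d y) ?fsubsetUr // -prodf_div; apply: eq_bigr => S _.
by rewrite mcoeffB expfzDr ?FSorder_neq0 // invr_expz.
Qed.

Lemma order_hom0 : order_hom 0 = 1.
Proof. by rewrite /order_hom msupp0 big_nil. Qed.

Lemma order_homN x : order_hom (- x) = (order_hom x)^-1.
Proof. by rewrite -sub0r order_homB order_hom0 div1r. Qed.

Lemma order_homD x y : order_hom (x + y) = order_hom x * order_hom y.
Proof. by rewrite -[y in LHS]opprK order_homB order_homN invrK. Qed.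

Lemma order_hom_formal_sum m : order_hom (formal_sum m) = (orders_prod m)%:R.
Proof.
rewrite /formal_sum /orders_prod; elim: m => [|S m IH].
  by rewrite !big_nil order_hom0.
rewrite !big_cons order_homD IH natrM; congr (_ * _).
by rewrite (order_homEw (msuppU_le)) big_seq_fset1 mcoeffUU.
Qed.

Lemma order_hom_eq1 a b :
  order_hom (formal_sum a - formal_sum b) = 1 <-> orders_prod a = orders_prod b.
Proof.
rewrite order_homB !order_hom_formal_sum.
have b0 : (orders_prod b)%:R != 0 :> rat.
  by rewrite Num.Theory.pnatr_eq0 -lt0n orders_prod_gt0.
split=> [/divr1_eq/eqP|->]; last exact: divff.
by rewrite Num.Theory.eqr_nat => /eqP.
Qed.

(** * Realisation of factors in free groups *)

Local Open Scope group_scope.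

Lemma free_on_image (F : groupType) (A B : set F) (I : Type) (e : I -> F) (f : F -> F) :
  free_on A e -> hom_on A f -> set_bij A B f -> free_on B (f \o e).
Proof.
move=> [sA Ae gen_e univ_e] fM [fA f_inj f_surj].
have fE : f @` A = B.
  by apply/seteqP; split=> // _ [x Ax <-]; apply: fA.
pose g y := xget 1 [set x | A x /\ f x = y].
have gK x : A x -> g (f x) = x.
  move=> Ax; have [|Ag fg] := @xgetPex _ 1 [set z | A z /\ f z = f x].
    by exists x.
  by apply: f_inj => //; apply/mem_set.
split=> [|i|C sC Cfe|H h].
- by rewrite -fE; apply: (subgroup_image sA).
- exact: fA.
- rewrite -fE => _ [x Ax <-].
  have Ce i : (A `&` f @^-1` C) (e i).
    by split; [exact: Ae|exact: Cfe].
  by have [] := gen_e _ (subgroup_preim sA fM sC) Ce x Ax.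
- have [k [kM ke]] := univ_e H h; exists (k \o g); split=> [|i]; last by rewrite /= gK.
  rewrite -fE => _ _ [x Ax <-] [y Ay <-].
  by rewrite /= -fM // !gK ?kM //; apply: subgroupM.
Qed.

(** Send the basis onto the list of the elements of K, padded with 1. *)
Lemma simple_quotient_exists (F : groupType) (A : set F) r (e : 'I_r -> F)
    (gT : finGroupType) (K : {group gT}) :
  free_on A e -> (#|K| <= r)%N ->
  exists2 N, normal_subgroup N A & quotient_iso A N K.
Proof.
move=> [sA Ae gen_e univ_e] leKr.
have [h [hM he]] := univ_e gT (fun i => nth 1 (enum K) i).
have hK x : A x -> h x \in K.
  suff sD : subgroup (A `&` h @^-1` [set` K]).
    move=> Ax; suff /(gen_e _ sD)/(_ x Ax)[] : forall i,
      (A `&` h @^-1` [set` K]) (e i) by [].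
    move=> i; split=> //=; rewrite he.
    have [ltiK|leKi] := ltnP i #|K|; first by rewrite -mem_enum mem_nth // -cardE.
    by rewrite nth_default ?group1 // -cardE.
  apply: (subgroup_preim sA hM); split=> [|u v]; rewrite /= ?group1 // => Ku Kv.
  by rewrite groupM ?groupV.
pose N := [set x | A x /\ h x = 1].
have hV := hom_onV sA hM.
have sN : subgroup N.
  split=> [|x y [Ax hx] [Ay hy]]; first by split; [apply: sA.1|apply: (hom_on1 sA hM)].
  split; first exact: sA.2.
  by rewrite hM ?hV ?hx ?hy ?invg1 ?mulg1 //; apply: subgroupV.
have NA : N `<=` A by move=> x [].
exists N.
  split=> // x y Ax [Ay hy]; have AVx := subgroupV sA Ax.
  have Ayx := subgroupM sA Ay Ax.
  by split; rewrite conjgE; [apply: subgroupM|rewrite !hM // hV // hy mul1g mulVg].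
apply/(quotient_isoP _ sA sN NA); exists h; split=> // [k Kk|x Ax]; last first.
  by split=> [hx|[]].
have ltk : (index k (enum K) < r)%N.
  by apply: leq_trans leKr; rewrite cardE index_mem mem_enum.
exists (e (Ordinal ltk)) => //.
by rewrite he /= nth_index // mem_enum.
Qed.

(** Passing to a subgroup of index k replaces the rank r by k(r - 1) + 1 >= r, so
    the bound on the orders remains valid all along the chain. *)
Lemma chain_realize (F : groupType) m (A : set F) r (e : 'I_r -> F) :
  (0 < r)%N -> free_on A e -> (forall S, S \in m -> (FSorder S <= r)%N) ->
  exists B, composition_chain A B m.
Proof.
elim: m A r e => [|S m IH] A r e r_gt0 free_e le_m.
  by exists A; apply: CompositionNil; have [] := free_e.
have [N nN qN] := simple_quotient_exists free_e (le_m S (mem_head S m)).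
have [r' [e' [free_e' eqr']]] := free_on_kernel free_e nN qN.
have ler : (r <= r')%N.
  have -> : r' = (FSorder S * r.-1 + 1)%N.
    apply: (@addIn (FSorder S)); rewrite [LHS]eqr' -{1}(prednK r_gt0) mulnS.
    by rewrite -addnA addnC.
  by rewrite addn1 -{1}(prednK r_gt0) ltnS leq_pmull // FSorder_gt0.
have [|T Tm|B chB] := IH N r' e' _ free_e'.
- exact: leq_trans ler.
- by apply: leq_trans ler; apply: le_m; rewrite inE Tm orbT.
- by exists B; apply: CompositionCons nN qN chB.
Qed.

(** * The image of d *)

Lemma prime_simple (gT : finGroupType) (K : {group gT}) : prime #|K| -> simple K.
Proof.
move=> pK; apply/simpleP; split=> [|H /normal_sub sHK].
  by rewrite trivg_card1; apply: contraTneq pK => ->.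
have [H1|/eqP ntH] := eqVneq (H : {set gT}) 1; [by left|right].
apply/eqP; rewrite eqEcard sHK -(prime_nt_dvdP pK _ (cardSg sHK)) //=.
by rewrite -trivg_card1; apply/eqP.
Qed.

Lemma FS_of_prime p : prime p -> exists S, FSorder S = p.
Proof.
move=> pp; have cZp : #|[group of Zp p]| = p by rewrite card_Zp ?prime_gt0.
have [|S /card_isog eqS] := @FS_surj _ [group of Zp p].
  by apply: prime_simple; rewrite cZp.
by exists S; rewrite /FSorder -eqS.
Qed.

Lemma FSorder_prime_inj S T : prime (FSorder S) -> FSorder S = FSorder T -> S = T.
Proof.
move=> pS eqST; apply: FS_inj; rewrite isog_cyclic_card; last exact: prime_cyclic.
have cT : #|FSgroup T| = FSorder S by rewrite eqST.
by rewrite prime_cyclic cT /=.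
Qed.

Section Range.
Variables (F : groupType) (n : nat) (e : 'I_n -> F).
Hypotheses (n_ge2 : (2 <= n)%N) (e_basis : free_basis e).

Let free_e := free_basis_on e_basis.

Lemma chain_orders_prod m : forall A r (e' : 'I_r -> F),
    composition_chain setT A m -> free_on A e' ->
  (r = orders_prod m * n.-1 + 1)%N.
Proof.
move=> A r e' ch free_e'.
have [r1 [e1 [free_e1 eq1]]] := chain_free ch free_e.
have -> : r = r1.
  apply/eqP; rewrite eqn_leq (free_on_rank_le free_e' free_e1).
  exact: (free_on_rank_le free_e1 free_e').
apply: (@addIn (orders_prod m)); rewrite [LHS]eq1 -{1}(prednK (ltnW n_ge2)) mulnS.
by rewrite -addnA addnC.
Qed.

Lemma orders_prod_inj m m' :
  (orders_prod m * n.-1 + 1 = orders_prod m' * n.-1 + 1)%N ->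
  orders_prod m = orders_prod m'.
Proof.
move=> /addIn/eqP; rewrite eqn_pmul2r; first by move/eqP.
by case: n n_ge2 => [|[]].
Qed.

Lemma order_hom_comm_d (c : Comm F) : order_hom (comm_d c) = 1%R.
Proof.
have [f [mf [mf' [chf chf' coefE]]]] := comm_d_representative c.
have -> : comm_d c = (formal_sum mf' - formal_sum mf)%R.
  by apply/malgP => S; rewrite coefE mcoeffB !formal_sum_coef.
apply/order_hom_eq1.
have [r [e1 [free_e1 _]]] := chain_free chf free_e.
have free_e2 := free_on_image free_e1 (@vi_morph _ f) (vi_bij f).
apply: orders_prod_inj.
by rewrite -(chain_orders_prod chf free_e1) -(chain_orders_prod chf' free_e2).
Qed.

(** The isomorphism goes from B to A, where A and B are obtained by realising a
    and b below a common subgroup A0 with N factors Z/2, hence of rank greater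
    than 2 ^ N >= N, with N the largest order in a and b. *)
Lemma comm_d_onto a b : orders_prod a = orders_prod b ->
  exists c : Comm F, comm_d c = (formal_sum a - formal_sum b)%R.
Proof.
move=> eq_ab; have [Z2 Z2order] := FS_of_prime (isT : prime 2).
pose N := (\max_(S <- a ++ b) FSorder S)%N.
have n_gt0 := ltnW n_ge2.
have [|A0 ch0] := chain_realize (m := nseq N Z2) n_gt0 free_e.
  by move=> S /nseqP[-> _]; rewrite Z2order.
have [r [e0 [free_e0 _]]] := chain_free ch0 free_e.
have ltNr : (N < r)%N.
  rewrite (chain_orders_prod ch0 free_e0) addn1 ltnS.
  have -> : orders_prod (nseq N Z2) = (2 ^ N)%N.
    by rewrite /orders_prod big_nseq Z2order -Monoid.iteropE.
  apply: (leq_trans (ltnW (ltn_expl N (ltnSn 1)))).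
  by rewrite leq_pmulr //; case: n n_ge2 => [|[]].
have r_gt0 : (0 < r)%N by apply: leq_ltn_trans ltNr.
have le_ab S : S \in a ++ b -> (FSorder S <= r)%N.
  by move=> Sab; apply: leq_trans (ltnW ltNr); apply: leq_bigmax_seq.
have [S Sb|B chB] := chain_realize (m := b) r_gt0 free_e0.
  by apply: le_ab; rewrite mem_cat Sb orbT.
have [S Sa|A chA] := chain_realize (m := a) r_gt0 free_e0.
  by apply: le_ab; rewrite mem_cat Sa.
have [rB [eB [free_B _]]] := chain_free chB free_e0.
have [rA [eA [free_A _]]] := chain_free chA free_e0.
have chB' := chain_cat ch0 chB; have chA' := chain_cat ch0 chA.
have eq_r : rB = rA.
  rewrite (chain_orders_prod chB' free_B) (chain_orders_prod chA' free_A).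
  by rewrite /orders_prod !big_cat /= -!/(orders_prod _) eq_ab.
case: rA / eq_r eA free_A => eA free_A.
have [f [f_bij fM]] := free_on_iso free_B free_A.
have [_ sB _] := chain_sub chB; have [_ sA _] := chain_sub chA.
pose phi := VirtualIso sB sA (chain_finite_index chB') (chain_finite_index chA') f_bij fM.
exists (Comm_class phi); apply/malgP => S.
rewrite (comm_d_class (f := phi) chB' chA') mcoeffB !formal_sum_coef !count_cat.
by rewrite !PoszD opprD addrACA subrr add0r.
Qed.

Lemma range_comm_d :
  range (@comm_d F) = [set x | order_hom x = 1%R].
Proof.
apply/seteqP; split=> [_ [c _ <-]|x]; first exact: order_hom_comm_d.
have [a [b ->]] := malg_formal_sums x.
by move=> /order_hom_eq1/comm_d_onto[c <-]; exists c.
Qed.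

End Range.

(** * A basis of the image *)

Local Open Scope ring_scope.

(** The p-adic valuation of [order_hom x] for p prime, as a linear form. *)
Definition order_val (p : nat) (x : {malg int[FS]}) : int :=
  mmap idfun (fun S => (logn p (FSorder S))%:Z) x.

Lemma order_val_formal_sum p m : order_val p (formal_sum m) = (logn p (orders_prod m))%:Z.
Proof.
rewrite /formal_sum /order_val /orders_prod.
elim: m => [|S m IH]; first by rewrite !big_nil mmap0 logn1.
rewrite !big_cons mmapD IH mmapU mul1r -PoszD lognM //; first exact: FSorder_gt0.
exact: orders_prod_gt0.
Qed.

Lemma order_hom_val x : order_hom x = 1 <-> forall p, order_val p x = 0.
Proof.
have [a [b ->]] := malg_formal_sums x; rewrite order_hom_eq1.
have valE p : order_val p (formal_sum a - formal_sum b) =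
    (logn p (orders_prod a))%:Z - (logn p (orders_prod b))%:Z.
  by rewrite -!order_val_formal_sum /order_val mmapB.
split=> [eq_ab p|val0]; first by rewrite valE eq_ab subrr.
apply: eqn_from_log; rewrite ?orders_prod_gt0 // => p.
by have /eqP := val0 p; rewrite valE subr_eq0 => /eqP[].
Qed.

Section PrimeBasis.
Variable C : nat -> FS.
Hypothesis orderC : forall p, prime p -> FSorder (C p) = p.

Definition nonprime_FS : Type := {S : FS | ~~ prime (FSorder S)}.
HB.instance Definition _ := Choice.on nonprime_FS.

Definition nonprime_basis (S : nonprime_FS) : {malg int[FS]} :=
  << 1 *g sval S >> -
  \sum_(p <- primes (FSorder (sval S))) << (logn p (FSorder (sval S)))%:Z *g C p >>.

Lemma nonprime_basis_val S p : order_val p (nonprime_basis S) = 0.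
Proof.
rewrite /order_val /nonprime_basis mmapB mmapU mul1r.
apply/eqP; rewrite subr_eq0; apply/eqP.
set k := FSorder (sval S); rewrite raddf_sum /=.
rewrite (eq_big_seq (fun q => (if q == p then logn q k else 0%N)%:Z)); last first.
  move=> q; rewrite mem_primes => /andP[pq _]; rewrite mmapU orderC //.
  by rewrite (logn_prime p pq) [p == q]eq_sym /=; case: eqP; rewrite ?mulr1 ?mulr0.
have [pk|npk] := boolP (p \in primes k).
  rewrite (bigD1_seq p) ?primes_uniq //= eqxx big1 ?addr0 // => q /negPf -> //.
rewrite big1_seq => [|q /andP[_ qk]]; last first.
  by case: eqP => // qp; rewrite -qp qk in npk.
by apply/eqP; rewrite eqz_nat -leqn0 leqNgt logn_gt0.
Qed.

(** The correction term is supported on the classes C p of prime order, so the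
    coordinates in this family are read off as coefficients. *)
Lemma nonprime_basis_coef (S T : nonprime_FS) :
  (nonprime_basis S)@_(sval T) = (S == T)%:R.
Proof.
rewrite /nonprime_basis mcoeffB mcoeffU raddf_sum /= big1_seq ?subr0 // => p.
rewrite mem_primes => /andP[_ /andP[pp _]]; rewrite mcoeffU.
case: eqP => [eqCT|_]; last by rewrite mulr0n.
by have := svalP T; rewrite -eqCT orderC ?pp.
Qed.

Lemma zlinear_comb_coef c (T : nonprime_FS) :
  (zlinear_comb nonprime_basis c)@_(sval T) = c@_T.
Proof.
rewrite /zlinear_comb [in RHS](monalgE c) !raddf_sum /=; apply: eq_bigr => S _.
by rewrite raddfMz /= nonprime_basis_coef mcoeffU; case: eqP => _;
  rewrite ?mulr1n ?mulr0n ?mul0rz ?intz.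
Qed.

Lemma zlinear_comb_val c p : order_val p (zlinear_comb nonprime_basis c) = 0.
Proof.
rewrite /zlinear_comb /order_val raddf_sum big1 // => S _.
by rewrite raddfMz /= -/(order_val _ _) nonprime_basis_val mul0rz.
Qed.

(** Only the groups of order p contribute to the valuation at p, and they are
    all isomorphic, so the valuation at p is the coefficient at Z/p. *)
Lemma order_val_eq0 (y : {malg int[FS]}) : (forall p, order_val p y = 0) ->
  (forall T : nonprime_FS, y@_(sval T) = 0) -> y = 0.
Proof.
move=> val0 y0; apply/malgP => T; rewrite mcoeff0.
have [pT|npT] := boolP (prime (FSorder T)); last exact: (y0 (exist _ T npT)).
rewrite -(val0 (FSorder T)) /order_val mmapE.
rewrite (eq_big_seq (fun S => if S == T then y@_S else 0)) => [|S Sy]; last first.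
  have pS : prime (FSorder S).
    apply: contraTT Sy => npS; rewrite -mcoeff_eq0.
    by apply/eqP/(y0 (exist _ S npS)).
  rewrite (logn_prime _ pS); have [->|/eqP neST] := eqVneq S T.
    by rewrite eqxx mulr1.
  by case: eqP => [/esym/(FSorder_prime_inj pS)//|]; rewrite mulr0.
rewrite -big_mkcond /= -big_filter.
have [Ty|Ty] := boolP (T \in msupp y).
  rewrite big_filter big_mkcond (bigD1_seq T) ?fset_uniq //= eqxx.
  by rewrite big1 ?addr0 // => S /negPf ->.
rewrite big_filter big1_seq ?mcoeff_outdom // => S /andP[/eqP -> Ty'].
by rewrite Ty' in Ty.
Qed.

Lemma nonprime_zbasis : zbasis [set x | order_hom x = 1] nonprime_basis.
Proof.
split=> [c _|c c' _ _ eq_cc'|x /order_hom_val x0].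
- by apply/order_hom_val => p; apply: zlinear_comb_val.
- by apply/malgP => T; rewrite -!zlinear_comb_coef eq_cc'.
pose E : {fset nonprime_FS} := seq_fset tt (pmap insub (msupp x)).
pose c : {malg int[nonprime_FS]} := \sum_(i <- E) << x@_(sval i) *g i >>.
have cE T : c@_T = x@_(sval T).
  rewrite mcoeff_sum_malgU seq_fsetE mem_pmap_sub.
  by case: ifPn => // /mcoeff_outdom ->.
exists c => //; apply/esym/eqP; rewrite -subr_eq0; apply/eqP.
apply: order_val_eq0 => [p|T].
  by rewrite /order_val mmapB -!/(order_val _ _) x0 zlinear_comb_val subrr.
by rewrite mcoeffB zlinear_comb_coef cE subrr.
Qed.

End PrimeBasis.

(** The alternating group of degree k + 5; as 4! divides (k + 5)!, its order is
    divisible by 12, hence not prime. *)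
Lemma FS_Alt k : exists S : nonprime_FS, (2 * FSorder (sval S))%N = (k + 5)`!.
Proof.
have lt5 : (4 < #|'I_(k + 5)|)%N by rewrite card_ord leq_addl.
have [S /card_isog eqS] := FS_surj (simple_Alt5 lt5).
have cS : (2 * FSorder S)%N = (k + 5)`!.
  by rewrite /FSorder -eqS card_Alt card_ord // (leq_trans _ (leq_addl k 5)).
suff npS : ~~ prime (FSorder S) by exists (exist _ S npS).
have : (2 * 12 %| 2 * FSorder S)%N.
  rewrite cS -(bin_fact (m := 4)) ?(leq_trans _ (leq_addl k 5)) //.
  by rewrite dvdn_mull // dvdn_mulr.
rewrite dvdn_pmul2l // => dvd12; apply/negP => pS.
have [] := primeP pS => _ /(_ _ dvd12)/orP[] // /eqP S12.
by rewrite -S12 in pS.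
Qed.

Lemma infinite_nonprime_FS : infinite_set [set: nonprime_FS].
Proof.
have [f fP] := choice FS_Alt.
have f_inj : injective f.
  move=> i j eq_f; have : (i + 5)`! = (j + 5)`! by rewrite -!fP eq_f.
  have lt_fact a b : (a < b)%N -> ((a + 5)`! < (b + 5)`!)%N.
    by move=> ltab; apply: ltn_fact; rewrite ?ltn_add2r // (leq_trans _ (leq_addl a 5)).
  by case: (ltngtP i j) => // /lt_fact + eqf; rewrite eqf ltnn.
move=> fin; apply: infinite_nat.
have -> : [set: nat] = f @^-1` [set: nonprime_FS] by [].
by apply: finite_preimage fin => i j _ _; apply: f_inj.
Qed.

Theorem proposition3p1 (F : groupType) (n : nat) (e : 'I_n -> F)
    (n_ge2 : (2 <= n)%N) (e_basis : free_basis e) :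
  range (@comm_d F) =
    [set x : {malg int[FS]} |
      \prod_(S <- msupp x) ((FSorder S)%:R : rat) ^ x@_S = 1] /\
  free_abelian_infinite_rank (range (@comm_d F)).
Proof.
have rangeE := range_comm_d n_ge2 e_basis; split; first exact: rangeE.
have /choice[C orderC] : forall p, exists S, prime p -> FSorder S = p.
  move=> p; have [S0 _] := FS_of_prime (isT : prime 2).
  have [/FS_of_prime[S oS]|_] := boolP (prime p); first by exists S.
  by exists S0.
exists nonprime_FS, (nonprime_basis C); split; first exact: infinite_nonprime_FS.
by rewrite rangeE; apply: nonprime_zbasis.
Qed.
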